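(* Let $N$ be the Nevanlinna class of the open unit disc $D(0,1)\subset\mathbb{C}$, and let $g$ be a holomorphic function on $D(0,1)$. If $\dfrac{1}{g'}\in N$, then there exists a function $f\in N$ such that $T_g(f)\notin N$, where $T_g$ is the Volterra operator with symbol $g$.
   Context: Let $D(0,1)=\{z\in\mathbb{C}:|z|<1\}$. For $x\ge 0$ define $\log^{+}x=\log x$ if $x\ge 1$ and $\log^{+}x=0$ if $0\le x<1$. The Nevanlinna class $N$ is the set of all holomorphic functions $f:D(0,1)\to\mathbb{C}$ such that $$\sup_{r\in(0,1)}\int_{0}^{2\pi}\log^{+}\left|f\left(re^{i\theta}\right)\right|\,d\theta<\infty.$$ In particular, the condition $1/g'\in N$ includes that $1/g'$ is holomorphic on $D(0,1)$, i.e. that $g'$ has no zeros in $D(0,1)$. For $g$ holomorphic on $D(0,1)$, the Volterra operator $T_g$ with symbol $g$ is defined on holomorphic functions $f$ on $D(0,1)$ by $$T_g(f)(z)=\frac{1}{z}\int_{[0,z]}f(\zeta)g'(\zeta)\,d\zeta,\qquad z\in D(0,1)\setminus\{0\},$$ where $[0,z]$ is the line segment from $0$ to $z$; the singularity at $z=0$ is removable and one sets $T_g(f)(0)=f(0)g'(0)$, so that $T_g(f)$ is holomorphic on $D(0,1)$. *)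

(* Defs.v *)
From Stdlib Require Import Reals.
From Coquelicot Require Import Coquelicot.

Open Scope R_scope.

(* Functions on the unit disc are represented by total functions C -> C; only
   their values at points of the disc are ever used. *)
Definition unit_disc (z : C) : Prop := Cmod z < 1.

Definition holomorphic_on_disc (f : C -> C) : Prop :=
  forall z : C, unit_disc z ->
    ex_derive (K := C_AbsRing) (V := C_NormedModule) f z.

Definition log_plus (x : R) : R := if Rle_dec 1 x then ln x else 0.

(* The point r * e^(i theta). *)
Definition polar (r theta : R) : C := (RtoC r * (cos theta, sin theta))%C.

Definition log_mean (f : C -> C) (r : R) : R :=
  RInt (fun theta : R => log_plus (Cmod (f (polar r theta)))) 0 (2 * PI).

(* The supremum is taken in the extended reals. For f holomorphic on the disc
   and 0 < r < 1 the integrand of log_mean is continuous, so the total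
   operator RInt is the genuine integral. *)
Definition Nevanlinna (f : C -> C) : Prop :=
  holomorphic_on_disc f /\
  Rbar_lt
    (Lub_Rbar (fun m : R => exists r : R, 0 < r < 1 /\ m = log_mean f r))
    p_infty.

(* Contour integral of h along the segment [a, b], parametrized by
   t |-> a + t (b - a) for t in [0, 1]. *)
Definition segment_integral (h : C -> C) (a b : C) : C :=
  RInt (V := C_R_CompleteNormedModule)
    (fun t : R => (h (a + RtoC t * (b - a)) * (b - a))%C) 0 1.

Definition Volterra (g f : C -> C) (z : C) : C :=
  if Ceq_dec z (RtoC 0) then (f (RtoC 0) * C_derive g (RtoC 0))%C
  else (/ z * segment_integral (fun w : C => f w * C_derive g w)
                (RtoC 0) z)%C.

(* Main.v *)
(** Multiplying by [1/g'] preserves [N], so it suffices to find [h] in [N] whose primitive is not in [N]; then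
    [f = h / g'] works, since [z T_g(f)(z)] is the primitive of [h] vanishing at [0].

    Let [w = (1 + z) / (1 - z)], which maps the disc onto the half-plane [Re w > 0], and [h(z) = F(w)] with
      [F(w) = sum_k 2^-k ((1 + eta_k^2) sinh(w / N_k))^N_k],  [N_k = 8 * 4^k],  [eta_k = (k + 1)^(-1/2)].
    On the imaginary axis the [k]-th term is nonnegative (as [4] divides [N_k]); it exceeds [1] only on peaks of
    relative width [eta_k], where its logarithm reaches about [N_k eta_k^2].  In the half-plane its logarithm is at
    most [Re w] plus a positive harmonic function whose value at [w = 1] is [O(eta_k^3)]; as [sum eta_k^3] converges,
    the mean value property puts [h] in [N].  Nothing cancels when [h] is integrated along the unit circle, so
    beyond the first peak of the [k]-th term (that is, for angles of order [1 / N_k]) the logarithm of the primitive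
    is at least [N_k eta_k^2 / 8].  These angles contribute at least a multiple of [eta_k^2 = 1 / (k + 1)] to the
    logarithmic mean, and the harmonic series diverges. *)

Require Import Defs.
From Stdlib Require Import Reals Lra Lia Psatz.
From Coquelicot Require Import Coquelicot.

(** * Complex derivatives *)

(** The powers of [eta_k] decide everything. A peak of relative width [eta_k] and logarithmic height
    of order [N_k eta_k^2] needs a harmonic majorant of weight [N_k eta_k^3], and evaluation at
    [w = 1] divides this by [N_k]. A primitive that has crossed the peak stays large on a whole
    range of angles of length about [1 / N_k], so its logarithm is charged [eta_k^2], without the
    factor for the width. The choice [(k + 1)^(-1/2)] lies between the two convergence conditions,
    and the growth of [4^k] keeps the ranges disjoint and lets the exponential absorb all losses
    polynomial in [2^k].

    The absence of cancellation is a sign: for [z = r e^(i theta)] the [theta]-derivative of the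
    imaginary part of the primitive is [Re (z h(z))]. On the unit circle [h] is real and
    nonnegative, so this is [h cos theta], which is nonnegative for [0 < theta <= 1].

    The peaks are computed on the circle [r = 1], where [h] is regular except at [1], while the
    means use [r < 1]. Hence finitely many peaks are fixed before [r] is chosen. *)

Notation cderiv := (is_derive (K := C_AbsRing) (V := C_NormedModule)).
Notation ccont := (continuous (T := C_UniformSpace) (U := C_UniformSpace)).

Lemma cderiv_eps (f : C -> C) (z l : C) :
  cderiv f z l <->
  forall eps, 0 < eps -> exists delta, 0 < delta /\
    forall y : C, Cmod (y - z) < delta ->
      Cmod (f y - f z - (y - z) * l) <= eps * Cmod (y - z).
Proof.
  split.
  - intros [_ H] eps He.
    specialize (H z (fun P HP => HP) (mkposreal eps He)).
    destruct H as [d Hd]. exists d; split; [apply cond_pos|].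
    intros y Hy. apply (Hd y). exact Hy.
  - intros H. split; [apply is_linear_scal_l|].
    intros x Hx. apply (is_filter_lim_locally_unique (K := C_AbsRing) (V := AbsRing_NormedModule C_AbsRing)) in Hx. subst x.
    intros [eps He]. destruct (H eps He) as [d [Hd H1]].
    exists (mkposreal d Hd). intros y Hy. apply H1. exact Hy.
Qed.

Lemma ccont_eps (f : C -> C) (z : C) :
  ccont f z <->
  forall eps, 0 < eps -> exists delta, 0 < delta /\
    forall y : C, Cmod (y - z) < delta -> Cmod (f y - f z) < eps.
Proof.
  unfold continuous, filterlim, filter_le, filtermap. split.
  - intros H eps He.
    assert (Hl : locally (T := C_UniformSpace) (f z) (fun w => Cmod (w - f z) < eps)).
    { apply locally_C. exists (mkposreal eps He). intros w Hw. exact Hw. }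
    apply H in Hl. apply locally_C in Hl. destruct Hl as [d Hd].
    exists d; split; [apply cond_pos|]. intros y Hy. apply (Hd y). exact Hy.
  - intros H P HP. apply locally_C in HP. destruct HP as [[e He] HP].
    destruct (H e He) as [d [Hd H1]].
    apply locally_C. exists (mkposreal d Hd). intros y Hy. apply HP. apply H1. exact Hy.
Qed.

Lemma cderiv_ccont (f : C -> C) (z l : C) : cderiv f z l -> ccont f z.
Proof.
  intros H. rewrite cderiv_eps in H. apply ccont_eps. intros eps He.
  destruct (H 1 Rlt_0_1) as [d [Hd H1]].
  pose proof (Cmod_ge_0 l) as Hl.
  exists (Rmin d (eps / (2 + Cmod l))). split.
  { apply Rmin_pos; auto. apply Rdiv_lt_0_compat; lra. }
  intros y Hy.
  assert (Hy1 : Cmod (y - z) < d) by (eapply Rlt_le_trans; [apply Hy|apply Rmin_l]).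
  assert (Hy2 : Cmod (y - z) < eps / (2 + Cmod l)) by (eapply Rlt_le_trans; [apply Hy|apply Rmin_r]).
  specialize (H1 y Hy1).
  replace (f y - f z)%C with ((f y - f z - (y - z) * l) + (y - z) * l)%C by ring.
  eapply Rle_lt_trans; [apply Cmod_triangle|]. rewrite Cmod_mult.
  apply (Rmult_lt_compat_r (2 + Cmod l)) in Hy2; [|lra].
  unfold Rdiv in Hy2. rewrite Rmult_assoc, Rinv_l, Rmult_1_r in Hy2 by lra.
  pose proof (Cmod_ge_0 (y - z)). nra.
Qed.

Lemma cderiv_const (c z : C) : cderiv (fun _ => c) z (RtoC 0).
Proof. apply (is_derive_const (K := C_AbsRing) (V := C_NormedModule)). Qed.

Lemma cderiv_id (z : C) : cderiv (fun w => w) z (RtoC 1).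
Proof.
  apply cderiv_eps. intros eps He. exists 1; split; [lra|]. intros y _.
  replace (y - z - (y - z) * 1)%C with (RtoC 0) by ring. rewrite Cmod_0.
  pose proof (Cmod_ge_0 (y - z)). nra.
Qed.

Lemma cderiv_plus (f g : C -> C) (z a b : C) :
  cderiv f z a -> cderiv g z b -> cderiv (fun w => f w + g w)%C z (a + b)%C.
Proof. apply (is_derive_plus (K := C_AbsRing) (V := C_NormedModule)). Qed.

Lemma cderiv_opp (f : C -> C) (z a : C) :
  cderiv f z a -> cderiv (fun w => - f w)%C z (- a)%C.
Proof. apply (is_derive_opp (K := C_AbsRing) (V := C_NormedModule)). Qed.

Lemma cderiv_minus (f g : C -> C) (z a b : C) :
  cderiv f z a -> cderiv g z b -> cderiv (fun w => f w - g w)%C z (a - b)%C.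
Proof. apply (is_derive_minus (K := C_AbsRing) (V := C_NormedModule)). Qed.

(** The product and chain rules differentiate in [AbsRing_NormedModule C_AbsRing], whereas
    [holomorphic_on_disc] uses [C_NormedModule]. The norms agree, so the remainder estimate passes
    over unchanged. *)
Lemma C_AbsRing_derive_iff (f : C -> C) (z l : C) :
  is_derive (K := C_AbsRing) (V := AbsRing_NormedModule C_AbsRing) f z l <-> cderiv f z l.
Proof.
  split; intros [H1 H2]; split; try apply is_linear_scal_l; intros x Hx; exact (H2 x Hx).
Qed.

Lemma cderiv_mult (f g : C -> C) (z a b : C) :
  cderiv f z a -> cderiv g z b ->
  cderiv (fun w => f w * g w)%C z (a * g z + f z * b)%C.
Proof.
  intros Hf Hg. apply C_AbsRing_derive_iff.
  apply (is_derive_mult (K := C_AbsRing)); try (apply C_AbsRing_derive_iff; assumption).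
  exact Cmult_comm.
Qed.

Lemma cderiv_comp (f g : C -> C) (z a b : C) :
  cderiv f (g z) a -> cderiv g z b -> cderiv (fun w => f (g w)) z (b * a)%C.
Proof.
  intros Hf Hg.
  apply (is_derive_comp (K := C_AbsRing) (V := C_NormedModule) f g); auto.
  apply C_AbsRing_derive_iff; assumption.
Qed.

Lemma cderiv_Cinv (z : C) : z <> RtoC 0 -> cderiv Cinv z (- / (z * z))%C.
Proof.
  intros Hz. apply cderiv_eps. intros eps He.
  assert (Hm : 0 < Cmod z) by (apply Cmod_gt_0; exact Hz).
  set (m := Cmod z) in *.
  exists (Rmin (m / 2) (eps * m ^ 3 / 2)). split.
  { apply Rmin_pos; [lra|]. apply Rdiv_lt_0_compat; [|lra]. apply Rmult_lt_0_compat; [lra|]. apply pow_lt; lra. }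
  intros y Hy.
  assert (Hy1 : Cmod (y - z) < m / 2) by (eapply Rlt_le_trans; [apply Hy|apply Rmin_l]).
  assert (Hy2 : Cmod (y - z) < eps * m ^ 3 / 2) by (eapply Rlt_le_trans; [apply Hy|apply Rmin_r]).
  assert (Hym : m / 2 <= Cmod y).
  { assert (m <= Cmod y + Cmod (y - z)); [|lra].
    unfold m. replace z with (y + - (y - z))%C at 1 by ring.
    eapply Rle_trans; [apply Cmod_triangle|]. rewrite Cmod_opp. lra. }
  assert (Hy0 : y <> RtoC 0). { intros ->. rewrite Cmod_0 in Hym. lra. }
  replace (/ y - / z - (y - z) * - / (z * z))%C with ((y - z) * (y - z) / (y * (z * z)))%C
    by (field; auto).
  assert (Hyzz : (y * (z * z))%C <> RtoC 0) by (repeat apply Cmult_neq_0; auto).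
  rewrite Cmod_div, !Cmod_mult by exact Hyzz. fold m.
  assert (Hd : 0 < Cmod y * (m * m)) by (apply Rmult_lt_0_compat; nra).
  apply Rmult_le_reg_r with (Cmod y * (m * m)); [exact Hd|].
  unfold Rdiv. rewrite Rmult_assoc, Rinv_l, Rmult_1_r by lra.
  pose proof (Cmod_ge_0 (y - z)) as H0.
  rewrite Rmult_assoc, (Rmult_comm eps), Rmult_assoc.
  apply Rmult_le_compat_l; [exact H0|].
  apply Rlt_le. eapply Rlt_le_trans; [exact Hy2|].
  simpl. assert (0 <= eps * (m * m)) by nra. nra.
Qed.

Lemma cderiv_inv (f : C -> C) (z a : C) :
  cderiv f z a -> f z <> RtoC 0 -> cderiv (fun w => / f w)%C z (- a / (f z * f z))%C.
Proof.
  intros Hf H0. replace (- a / (f z * f z))%C with (a * (- / (f z * f z)))%C by (field; auto).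
  apply (cderiv_comp Cinv f); auto. apply cderiv_Cinv; auto.
Qed.

Lemma cderiv_pow (f : C -> C) (n : nat) (z a : C) :
  cderiv f z a -> cderiv (fun w => f w ^ n)%C z (RtoC (INR n) * a * f z ^ pred n)%C.
Proof.
  intros Hf. induction n as [|n IH].
  - replace (RtoC (INR 0) * a * f z ^ pred 0)%C with (RtoC 0) by (simpl; ring).
    apply (cderiv_const (RtoC 1)).
  - replace (RtoC (INR (S n)) * a * f z ^ pred (S n))%C
      with (a * f z ^ n + f z * (RtoC (INR n) * a * f z ^ pred n))%C.
    + apply (cderiv_mult f (fun w => f w ^ n)%C); auto.
    + rewrite S_INR, RtoC_plus. destruct n as [|n]; simpl; ring.
Qed.

Lemma cderiv_eq (f : C -> C) (z a b : C) : cderiv f z a -> a = b -> cderiv f z b.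
Proof. intros H <-. exact H. Qed.

Lemma cderiv_ext (f g : C -> C) (z a : C) :
  (forall w, f w = g w) -> cderiv f z a -> cderiv g z a.
Proof. apply (is_derive_ext (K := C_AbsRing) (V := C_NormedModule)). Qed.

Definition Cexp (z : C) : C := (exp (fst z) * cos (snd z), exp (fst z) * sin (snd z)).

Lemma Cexp_plus (z w : C) : Cexp (z + w) = (Cexp z * Cexp w)%C.
Proof.
  destruct z as [a b], w as [c d]. unfold Cexp, Cplus, Cmult; simpl.
  rewrite exp_plus, cos_plus, sin_plus. f_equal; ring.
Qed.

Lemma Cmod_Cexp (z : C) : Cmod (Cexp z) = exp (fst z).
Proof.
  unfold Cmod, Cexp; simpl.
  replace (_ + _) with (exp (fst z) * exp (fst z)).
  - apply sqrt_square. apply Rlt_le, exp_pos.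
  - pose proof (sin2_cos2 (snd z)) as H. unfold Rsqr in H. nra.
Qed.

Lemma Cexp_0 : Cexp 0 = RtoC 1.
Proof. unfold Cexp, RtoC; simpl. rewrite exp_0, cos_0, sin_0. f_equal; ring. Qed.

Lemma Rabs_fst_le_Cmod (z : C) : Rabs (fst z) <= Cmod z.
Proof. apply (Rle_trans _ (Rmax (Rabs (fst z)) (Rabs (snd z)))); [apply Rmax_l|apply Rmax_Cmod]. Qed.

Lemma Rabs_snd_le_Cmod (z : C) : Rabs (snd z) <= Cmod z.
Proof. apply (Rle_trans _ (Rmax (Rabs (fst z)) (Rabs (snd z)))); [apply Rmax_r|apply Rmax_Cmod]. Qed.

Lemma Cmod_le_sum (z : C) : Cmod z <= Rabs (fst z) + Rabs (snd z).
Proof.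
  destruct z as [a b]. replace (a, b) with (RtoC a + Ci * RtoC b)%C.
  - eapply Rle_trans; [apply Cmod_triangle|]. rewrite Cmod_mult, !Cmod_R.
    rewrite Cmod_Ci. simpl. rewrite Rmult_1_l.
    replace (a + (0 * b - 1 * 0)) with a by ring.
    replace (0 + (0 * 0 + 1 * b)) with b by ring. lra.
  - unfold RtoC, Ci, Cplus, Cmult; simpl. f_equal; ring.
Qed.

Lemma real_derive_eps (f : R -> R) (t l : R) :
  is_derive f t l <->
  forall eps, 0 < eps -> exists delta, 0 < delta /\
    forall s, Rabs (s - t) < delta -> Rabs (f s - f t - (s - t) * l) <= eps * Rabs (s - t).
Proof.
  split.
  - intros [_ H] eps He.
    specialize (H t (fun P HP => HP) (mkposreal eps He)).
    destruct H as [d Hd]. exists d; split; [apply cond_pos|].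
    intros y Hy. apply (Hd y). exact Hy.
  - intros H. split; [apply is_linear_scal_l|].
    intros x Hx.
    apply (is_filter_lim_locally_unique (K := R_AbsRing) (V := R_NormedModule)) in Hx. subst x.
    intros [eps He]. destruct (H eps He) as [d [Hd H1]].
    exists (mkposreal d Hd). intros y Hy. apply H1. exact Hy.
Qed.

(** Since [c s - c t] is [O(s - t)], the complex remainder of [f] is [o(s - t)]. Splitting into
    components makes real calculus (mean value theorem, [RInt]) available for holomorphic functions
    along circles, radii and segments. *)
Lemma cderiv_curve (f : C -> C) (c : R -> C) (t : R) (l v : C) :
  cderiv f (c t) l ->
  is_derive (fun s => fst (c s)) t (fst v) -> is_derive (fun s => snd (c s)) t (snd v) ->
  is_derive (fun s => fst (f (c s))) t (fst (l * v)%C) /\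
  is_derive (fun s => snd (f (c s))) t (snd (l * v)%C).
Proof.
  rewrite cderiv_eps, !real_derive_eps. intros Hf H1 H2.
  assert (Hc : forall eps, 0 < eps -> exists delta, 0 < delta /\ forall s, Rabs (s - t) < delta ->
            Cmod (c s - c t - RtoC (s - t) * v) <= eps * Rabs (s - t)).
  { intros eps He.
    destruct (H1 (eps / 2) ltac:(lra)) as [d1 [Hd1 K1]].
    destruct (H2 (eps / 2) ltac:(lra)) as [d2 [Hd2 K2]].
    exists (Rmin d1 d2); split; [apply Rmin_pos; auto|]. intros s Hs.
    specialize (K1 s (Rlt_le_trans _ _ _ Hs (Rmin_l _ _))).
    specialize (K2 s (Rlt_le_trans _ _ _ Hs (Rmin_r _ _))).
    eapply Rle_trans; [apply Cmod_le_sum|].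
    destruct (c s) as [a b], (c t) as [a' b'], v as [v1 v2]. simpl in *.
    replace (a + - a' + - ((s - t) * v1 - 0 * v2)) with (a - a' - (s - t) * v1) by ring.
    replace (b + - b' + - ((s - t) * v2 + 0 * v1)) with (b - b' - (s - t) * v2) by ring.
    lra. }
  assert (Hm : forall eps, 0 < eps -> exists delta, 0 < delta /\ forall s, Rabs (s - t) < delta ->
            Cmod (f (c s) - f (c t) - RtoC (s - t) * (l * v)) <= eps * Rabs (s - t)).
  { intros eps He.
    pose proof (Cmod_ge_0 v) as Hv. pose proof (Cmod_ge_0 l) as Hl.
    (* The cap [1] in [e2] gives the Lipschitz bound [(1 + Cmod v) * Rabs (s - t)] for [c]; the two
       quotients give each of the two error terms half of [eps]. *)
    set (e1 := eps / (2 * (1 + Cmod v))). set (e2 := Rmin 1 (eps / (2 * (1 + Cmod l)))).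
    assert (He1 : 0 < e1) by (apply Rdiv_lt_0_compat; lra).
    assert (He2 : 0 < e2) by (apply Rmin_pos; [lra|apply Rdiv_lt_0_compat; lra]).
    destruct (Hf e1 He1) as [d1 [Hd1 K1]].
    destruct (Hc e2 He2) as [d2 [Hd2 K2]].
    exists (Rmin d2 (d1 / (1 + Cmod v))); split.
    { apply Rmin_pos; auto. apply Rdiv_lt_0_compat; lra. }
    intros s Hs.
    assert (Hs2 := Rlt_le_trans _ _ _ Hs (Rmin_l _ _)).
    assert (Hs1 := Rlt_le_trans _ _ _ Hs (Rmin_r _ _)). clear Hs.
    specialize (K2 s Hs2).
    pose proof (Rabs_pos (s - t)) as Ha.
    assert (e2 <= 1) as He21 by apply Rmin_l.
    assert (He22 : e2 * (2 * (1 + Cmod l)) <= eps).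
    { apply Rle_trans with (eps / (2 * (1 + Cmod l)) * (2 * (1 + Cmod l))).
      - apply Rmult_le_compat_r; [lra|apply Rmin_r].
      - right. field. lra. }
    assert (He11 : e1 * (2 * (1 + Cmod v)) = eps) by (unfold e1; field; lra).
    assert (Hq : Cmod (c s - c t) <= (1 + Cmod v) * Rabs (s - t)).
    { replace (c s - c t)%C with ((c s - c t - RtoC (s - t) * v) + RtoC (s - t) * v)%C by ring.
      eapply Rle_trans; [apply Cmod_triangle|]. rewrite Cmod_mult, Cmod_R. nra. }
    assert (Hq' : Cmod (c s - c t) < d1).
    { eapply Rle_lt_trans; [exact Hq|].
      apply (Rmult_lt_compat_l (1 + Cmod v)) in Hs1; [|lra].
      replace ((1 + Cmod v) * (d1 / (1 + Cmod v))) with d1 in Hs1 by (field; lra). exact Hs1. }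
    specialize (K1 (c s) Hq').
    replace (f (c s) - f (c t) - RtoC (s - t) * (l * v))%C
      with ((f (c s) - f (c t) - (c s - c t) * l) + (c s - c t - RtoC (s - t) * v) * l)%C by ring.
    eapply Rle_trans; [apply Cmod_triangle|]. rewrite Cmod_mult.
    assert (e1 * Cmod (c s - c t) <= eps / 2 * Rabs (s - t)).
    { apply Rle_trans with (e1 * ((1 + Cmod v) * Rabs (s - t))); [apply Rmult_le_compat_l; lra|].
      right. rewrite <- He11. field. }
    assert (Cmod (c s - c t - RtoC (s - t) * v) * Cmod l <= eps / 2 * Rabs (s - t)).
    { apply Rle_trans with (e2 * Rabs (s - t) * Cmod l); [apply Rmult_le_compat_r; lra|].
      assert (e2 * Cmod l <= eps / 2) by nra. nra. }
    lra. }
  split; intros eps He; destruct (Hm eps He) as [d [Hd K]]; exists d; (split; [exact Hd|]);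
    intros s Hs; specialize (K s Hs); (eapply Rle_trans; [|exact K]).
  - eapply Rle_trans; [|apply Rabs_fst_le_Cmod]. right. f_equal. simpl. ring.
  - eapply Rle_trans; [|apply Rabs_snd_le_Cmod]. right. f_equal. simpl. ring.
Qed.

(** * The complex exponential and continuity *)

(** At [0] the real derivatives of [exp], [cos] and [sin] suffice; the functional equation
    [Cexp w = Cexp z * Cexp (w - z)] carries the result to every [z]. *)
Lemma cderiv_Cexp (z : C) : cderiv Cexp z (Cexp z).
Proof.
  assert (H0 : cderiv Cexp (RtoC 0) (RtoC 1)).
  { apply cderiv_eps. intros eps He.
    set (e := Rmin 1 (eps / 16)).
    assert (Hep : 0 < e) by (apply Rmin_pos; lra).
    assert (He1 : e <= 1) by apply Rmin_l. assert (He2 : e <= eps / 16) by apply Rmin_r.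
    assert (Dexp : is_derive exp 0 1) by (auto_derive; [exact I|rewrite exp_0; ring]).
    assert (Dcos : is_derive cos 0 0) by (auto_derive; [exact I|rewrite sin_0; ring]).
    assert (Dsin : is_derive sin 0 1) by (auto_derive; [exact I|rewrite cos_0; ring]).
    rewrite real_derive_eps in Dexp, Dcos, Dsin.
    destruct (Dexp e Hep) as [d1 [Hd1 K1]]. destruct (Dcos e Hep) as [d2 [Hd2 K2]].
    destruct (Dsin e Hep) as [d3 [Hd3 K3]]. rewrite exp_0 in K1. rewrite cos_0 in K2. rewrite sin_0 in K3.
    exists (Rmin (Rmin d1 e) (Rmin d2 d3)). split; [apply Rmin_pos; apply Rmin_pos; assumption|].
    intros [x y] Hy.
    replace (Cexp (x, y) - Cexp 0 - ((x, y) - 0) * 1)%C with (Cexp (x, y) - 1 - (x, y))%C by (rewrite Cexp_0; ring).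
    replace ((x, y) - 0)%C with (x, y) in * by (unfold Cminus, Cplus, Copp, RtoC; simpl; f_equal; ring).
    pose proof (Rabs_fst_le_Cmod (x, y)) as Hx'. pose proof (Rabs_snd_le_Cmod (x, y)) as Hy'. simpl in Hx', Hy'.
    set (m := Cmod (x, y)) in *.
    pose proof (Rlt_le_trans _ _ _ Hy (Rmin_l _ _)) as Ha. pose proof (Rlt_le_trans _ _ _ Hy (Rmin_r _ _)) as Hb.
    pose proof (Rlt_le_trans _ _ _ Ha (Rmin_l _ _)) as Ha1. pose proof (Rlt_le_trans _ _ _ Ha (Rmin_r _ _)) as Ha2.
    pose proof (Rlt_le_trans _ _ _ Hb (Rmin_l _ _)) as Hb1. pose proof (Rlt_le_trans _ _ _ Hb (Rmin_r _ _)) as Hb2.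
    specialize (K1 x ltac:(rewrite Rminus_0_r; lra)). specialize (K2 y ltac:(rewrite Rminus_0_r; lra)).
    specialize (K3 y ltac:(rewrite Rminus_0_r; lra)). rewrite !Rminus_0_r in K1, K2.
    replace (sin y - 0 - (y - 0) * 1) with (sin y - y * 1) in K3 by ring. rewrite Rminus_0_r in K3.
    eapply Rle_trans; [apply Cmod_le_sum|]. unfold Cexp; simpl.
    pose proof (exp_pos x) as Ep.
    pose proof (Rabs_pos x) as Px. pose proof (Rabs_pos y) as Py.
    assert (E1 : Rabs (exp x - 1) <= 2 * m).
    { replace (exp x - 1) with ((exp x - 1 - x * 1) + x) by ring.
      eapply Rle_trans; [apply Rabs_triang|]. nra. }
    assert (E2 : exp x <= 3). { apply Rabs_le_between in E1. lra. }
    replace (exp x * cos y + - (1) + - x) with ((exp x - 1 - x * 1) + exp x * (cos y - 1 - y * 0)) by ring.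
    replace (exp x * sin y + - 0 + - y) with (exp x * (sin y - y * 1) + (exp x - 1) * y) by ring.
    assert (A1 := Rabs_triang (exp x - 1 - x * 1) (exp x * (cos y - 1 - y * 0))).
    assert (A2 := Rabs_triang (exp x * (sin y - y * 1)) ((exp x - 1) * y)).
    rewrite Rabs_mult, (Rabs_pos_eq (exp x)) in A1 by lra.
    rewrite !Rabs_mult, (Rabs_pos_eq (exp x)) in A2 by lra.
    pose proof (Rabs_pos (exp x - 1)). pose proof (Rabs_pos (cos y - 1 - y * 0)). pose proof (Rabs_pos (sin y - y * 1)).
    assert (B1 : exp x * Rabs (cos y - 1 - y * 0) <= 3 * (e * m)) by (apply Rmult_le_compat; nra).
    assert (B2 : exp x * Rabs (sin y - y * 1) <= 3 * (e * m)) by (apply Rmult_le_compat; nra).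
    assert (B3 : Rabs (exp x - 1) * Rabs y <= 2 * e * m) by (apply Rmult_le_compat; nra).
    assert (B4 : e * Rabs x <= e * m) by nra.
    assert (e * m <= eps / 16 * m) by nra. nra. }
  apply (cderiv_ext (fun w => Cexp z * Cexp (w - z))%C).
  { intros w. rewrite <- Cexp_plus. f_equal. ring. }
  eapply cderiv_eq.
  - apply (cderiv_mult (fun _ => Cexp z) (fun w => Cexp (w - z))); [apply cderiv_const|].
    apply (cderiv_comp Cexp (fun w => w - z)%C z (RtoC 1) (RtoC 1)).
    + replace (z - z)%C with (RtoC 0) by ring. exact H0.
    + eapply cderiv_eq; [apply (cderiv_minus (fun w => w) (fun _ => z)); [apply cderiv_id|apply cderiv_const]|]. ring.
  - ring.
Qed.

Lemma continuous_fst_snd (U : UniformSpace) (f : U -> C) (x : U) :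
  continuous (T := U) (U := C_UniformSpace) f x <->
  continuous (fun y => fst (f y)) x /\ continuous (fun y => snd (f y)) x.
Proof.
  split.
  - intros H. split.
    + apply (continuous_comp f fst); [exact H|]. apply (continuous_fst (U := R_UniformSpace) (V := R_UniformSpace)).
    + apply (continuous_comp f snd); [exact H|]. apply (continuous_snd (U := R_UniformSpace) (V := R_UniformSpace)).
  - intros [H1 H2] P [e He].
    specialize (H1 (fun a => ball (fst (f x)) e a) (ex_intro _ e (fun y H => H))).
    specialize (H2 (fun a => ball (snd (f x)) e a) (ex_intro _ e (fun y H => H))).
    unfold filtermap in *. generalize (filter_and _ _ H1 H2).
    apply filter_imp. intros y [A B]. apply He. split; assumption.
Qed.

Lemma continuous_Cmult (U : UniformSpace) (f g : U -> C) (x : U) :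
  continuous (T := U) (U := C_UniformSpace) f x -> continuous (T := U) (U := C_UniformSpace) g x ->
  continuous (T := U) (U := C_UniformSpace) (fun y => f y * g y)%C x.
Proof.
  rewrite !continuous_fst_snd. intros [A B] [A' B']. split; simpl.
  - apply (continuous_minus (V := R_NormedModule)
             (fun y => fst (f y) * fst (g y)) (fun y => snd (f y) * snd (g y)));
      apply (continuous_mult (K := R_AbsRing)); assumption.
  - apply (continuous_plus (V := R_NormedModule)
             (fun y => fst (f y) * snd (g y)) (fun y => snd (f y) * fst (g y)));
      apply (continuous_mult (K := R_AbsRing)); assumption.
Qed.

Lemma continuous_Cplus (U : UniformSpace) (f g : U -> C) (x : U) :
  continuous (T := U) (U := C_UniformSpace) f x -> continuous (T := U) (U := C_UniformSpace) g x ->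
  continuous (T := U) (U := C_UniformSpace) (fun y => f y + g y)%C x.
Proof.
  rewrite !continuous_fst_snd. intros [A B] [A' B'].
  split; simpl; apply (continuous_plus (V := R_NormedModule)); assumption.
Qed.

Lemma continuous_Cmod (U : UniformSpace) (f : U -> C) (x : U) :
  continuous (T := U) (U := C_UniformSpace) f x -> continuous (fun y => Cmod (f y)) x.
Proof.
  rewrite continuous_fst_snd. intros [A B]. unfold Cmod.
  apply (continuous_comp (fun y => fst (f y) ^ 2 + snd (f y) ^ 2) sqrt).
  - assert (Sq : forall g : U -> R, continuous g x -> continuous (fun y => g y ^ 2) x).
    { intros g Hg. apply (continuous_mult (K := R_AbsRing) g (fun y => g y * 1)); [exact Hg|].
      apply (continuous_mult (K := R_AbsRing) g (fun _ => 1)); [exact Hg|apply continuous_const]. }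
    apply (continuous_plus (V := R_NormedModule) (fun y => fst (f y) ^ 2) (fun y => snd (f y) ^ 2)).
    + apply (Sq (fun y => fst (f y)) A).
    + apply (Sq (fun y => snd (f y)) B).
  - apply continuous_sqrt.
Qed.

Lemma continuous_RtoC (U : UniformSpace) (f : U -> R) (x : U) :
  continuous f x -> continuous (T := U) (U := C_UniformSpace) (fun y => RtoC (f y)) x.
Proof. intros H. apply continuous_fst_snd. split; simpl; [exact H|apply continuous_const]. Qed.

Lemma continuous_polar (U : UniformSpace) (f g : U -> R) (x : U) :
  continuous f x -> continuous g x ->
  continuous (T := U) (U := C_UniformSpace) (fun y => polar (f y) (g y)) x.
Proof.
  intros Hf Hg. apply continuous_Cmult; [apply continuous_RtoC, Hf|].
  apply continuous_fst_snd. split; simpl.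
  - apply (continuous_comp g cos); [exact Hg|apply continuous_cos].
  - apply (continuous_comp g sin); [exact Hg|apply continuous_sin].
Qed.

Lemma continuous_2d (f : R -> R -> R) (x y : R) :
  continuous (T := C_UniformSpace) (fun p : C => f (fst p) (snd p)) (x, y) -> continuity_2d_pt f x y.
Proof. intros H. apply continuity_2d_pt_filterlim. exact H. Qed.

Lemma Cmod_cos_sin (theta : R) : Cmod (cos theta, sin theta) = 1.
Proof.
  unfold Cmod; simpl. pose proof (sin2_cos2 theta) as H. unfold Rsqr in H.
  replace (_ + _) with 1 by lra. apply sqrt_1.
Qed.

Lemma Cmod_polar (r theta : R) : Cmod (polar r theta) = Rabs r.
Proof. unfold polar. rewrite Cmod_mult, Cmod_cos_sin, Cmod_R. ring. Qed.

Lemma is_derive_polar_r (r theta : R) :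
  is_derive (fun s => fst (polar s theta)) r (cos theta) /\
  is_derive (fun s => snd (polar s theta)) r (sin theta).
Proof. unfold polar; simpl. split; auto_derive; auto; ring. Qed.

Lemma is_derive_polar_theta (r theta : R) :
  is_derive (fun s => fst (polar r s)) theta (fst (Ci * polar r theta)%C) /\
  is_derive (fun s => snd (polar r s)) theta (snd (Ci * polar r theta)%C).
Proof. unfold polar; simpl. split; auto_derive; auto; ring. Qed.

(** Continuity of the derivative is recorded as data: differentiation under the integral sign needs
    it, and carrying it along avoids deducing it from differentiability through Goursat's
    theorem. *)
Definition C1_on (D : C -> Prop) (f f' : C -> C) : Prop :=
  forall z, D z -> cderiv f z (f' z) /\ ccont f' z.

(** * Integrals of holomorphic functions along circles and radii *)

Lemma unit_disc_polar (r theta : R) : Rabs r < 1 -> unit_disc (polar r theta).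
Proof. unfold unit_disc. rewrite Cmod_polar. auto. Qed.

Lemma continuous_disc_curve (U : UniformSpace) (D : C -> Prop) (f f' : C -> C) (c : U -> C) (x : U) :
  C1_on D f f' -> D (c x) -> continuous (T := U) (U := C_UniformSpace) c x ->
  continuous (T := U) (U := C_UniformSpace) (fun y => f (c y)) x /\
  continuous (T := U) (U := C_UniformSpace) (fun y => f' (c y)) x.
Proof.
  intros H Hx Hc. destruct (H _ Hx) as [H1 H2]. apply cderiv_ccont in H1.
  split; apply (continuous_comp (V := C_UniformSpace) (W := C_UniformSpace)); assumption.
Qed.

Lemma continuous_fst_C (U : UniformSpace) (f : U -> C) (x : U) :
  continuous (T := U) (U := C_UniformSpace) f x -> continuous (fun y => fst (f y)) x.
Proof. intros H. apply continuous_fst_snd in H. apply H. Qed.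

Lemma continuous_snd_C (U : UniformSpace) (f : U -> C) (x : U) :
  continuous (T := U) (U := C_UniformSpace) f x -> continuous (fun y => snd (f y)) x.
Proof. intros H. apply continuous_fst_snd in H. apply H. Qed.

Lemma continuous_cos_sin (U : UniformSpace) (g : U -> R) (x : U) :
  continuous g x -> continuous (T := U) (U := C_UniformSpace) (fun y => (cos (g y), sin (g y))) x.
Proof.
  intros H. apply continuous_fst_snd. split; simpl.
  - apply (continuous_comp g cos); [exact H|apply continuous_cos].
  - apply (continuous_comp g sin); [exact H|apply continuous_sin].
Qed.

Lemma continuous_pair_fst (x : C_UniformSpace) : continuous (T := C_UniformSpace) (fun p : C => fst p) x.
Proof. apply (continuous_fst (U := R_UniformSpace) (V := R_UniformSpace)). Qed.

Lemma continuous_pair_snd (x : C_UniformSpace) : continuous (T := C_UniformSpace) (fun p : C => snd p) x.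
Proof. apply (continuous_snd (U := R_UniformSpace) (V := R_UniformSpace)). Qed.

Lemma locally_Rabs_lt (s a : R) : Rabs s < a -> locally s (fun u => Rabs u < a).
Proof.
  intros Hs. exists (mkposreal (a - Rabs s) ltac:(lra)). intros y Hy.
  change (Rabs (y - s) < a - Rabs s) in Hy.
  pose proof (Rabs_triang_inv y s). lra.
Qed.

(** The circular mean [M] is constant in the radius. By the Cauchy-Riemann equation in polar form,
    the radial derivative of [Re f] is [1 / s] times the angular derivative of [Im f], whose
    integral over a period vanishes. This needs [s > 0]; the centre is reached by continuity of [M]
    at [0]. *)
Lemma mean_value_property (f f' : C -> C) (r : R) :
  C1_on unit_disc f f' -> 0 < r < 1 ->
  RInt (fun theta => fst (f (polar r theta))) 0 (2 * PI) = 2 * PI * fst (f (RtoC 0)).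
Proof.
  intros Hf Hr.
  set (M := fun s => RInt (fun theta => fst (f (polar s theta))) 0 (2 * PI)).
  assert (Dr : forall s theta, Rabs s < 1 ->
    is_derive (fun u => fst (f (polar u theta))) s (fst (f' (polar s theta) * (cos theta, sin theta))%C)).
  { intros s theta Hs. destruct (Hf _ (unit_disc_polar s theta Hs)) as [H _].
    destruct (is_derive_polar_r s theta) as [A B].
    apply (cderiv_curve f (fun u => polar u theta) s _ (cos theta, sin theta) H A B). }
  assert (Cf : forall s theta, Rabs s < 1 -> continuous (fun t => fst (f (polar s t))) theta).
  { intros s theta Hs. apply continuous_fst_C.
    apply (continuous_disc_curve R_UniformSpace unit_disc f f' (fun t => polar s t) theta Hf).
    - apply unit_disc_polar, Hs.
    - apply continuous_polar; [apply continuous_const|apply continuous_id]. }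
  assert (DM : forall s, Rabs s < 1 ->
    is_derive M s (RInt (fun theta => fst (f' (polar s theta) * (cos theta, sin theta))%C) 0 (2 * PI))).
  { intros s Hs.
    assert (Hloc : locally s (fun u => Rabs u < 1)).
    { apply (locally_Rabs_lt s 1 Hs). }
    replace (RInt (fun theta => fst (f' (polar s theta) * (cos theta, sin theta))%C) 0 (2 * PI))
      with (RInt (fun t => Derive (fun u => fst (f (polar u t))) s) 0 (2 * PI)).
    2:{ apply RInt_ext. intros x _. apply is_derive_unique, Dr, Hs. }
    apply (is_derive_RInt_param (fun s t => fst (f (polar s t))) 0 (2 * PI) s).
    - revert Hloc. apply filter_imp. intros u Hu t _. eexists. apply Dr, Hu.
    - intros t _.
      apply continuity_2d_pt_ext_loc with (fun u v => fst (f' (polar u v) * (cos v, sin v))%C).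
      + exists (mkposreal (1 - Rabs s) ltac:(lra)). intros u v Hu Hv. simpl in Hu.
        symmetry. apply is_derive_unique, Dr.
        pose proof (Rabs_triang (u - s) s) as T. replace (u - s + s) with u in T by ring. lra.
      + apply continuous_2d. apply continuous_fst_C. apply continuous_Cmult.
        * apply (continuous_disc_curve C_UniformSpace unit_disc f f' (fun p => polar (fst p) (snd p)) (s, t) Hf).
          -- apply unit_disc_polar, Hs.
          -- apply continuous_polar; [apply continuous_pair_fst|apply continuous_pair_snd].
        * apply continuous_cos_sin, continuous_pair_snd.
    - revert Hloc. apply filter_imp. intros u Hu.
      apply (ex_RInt_continuous (V := R_CompleteNormedModule)). intros z _. apply Cf, Hu. }
  assert (DM0 : forall s, 0 < s < 1 -> is_derive M s 0).
  { intros s Hs. assert (Ha : Rabs s < 1) by (rewrite Rabs_pos_eq; lra).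
    specialize (DM s Ha).
    replace (RInt _ _ _) with 0 in DM; [exact DM|].
    symmetry. apply is_RInt_unique.
    assert (I : is_RInt (fun theta => fst (f' (polar s theta) * (cos theta, sin theta))%C) 0 (2 * PI)
              (minus (/ s * snd (f (polar s (2 * PI)))) (/ s * snd (f (polar s 0))))).
    { apply (is_RInt_derive (fun theta => / s * snd (f (polar s theta)))).
      - intros x _.
        destruct (Hf _ (unit_disc_polar s x Ha)) as [H _].
        destruct (is_derive_polar_theta s x) as [A B].
        destruct (cderiv_curve f (fun u => polar s u) x _ (Ci * polar s x)%C H A B) as [_ K].
        apply (is_derive_scal _ _ (/ s)) in K.
        replace (fst (f' (polar s x) * (cos x, sin x))%C)
          with (/ s * snd (f' (polar s x) * (Ci * polar s x))%C); [exact K|].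
        unfold polar; simpl. field. lra.
      - intros x _. apply continuous_fst_C. apply continuous_Cmult.
        + apply (continuous_disc_curve R_UniformSpace unit_disc f f' (fun t => polar s t) x Hf).
          * apply unit_disc_polar, Ha.
          * apply continuous_polar; [apply continuous_const|apply continuous_id].
        + apply continuous_cos_sin, continuous_id. }
    replace (minus _ _) with 0 in I; [exact I|].
    unfold polar. rewrite cos_2PI, sin_2PI, cos_0, sin_0.
    unfold minus, plus, opp; simpl. ring. }
  destruct (MVT_gen M 0 r (fun _ => 0)) as [c [_ Hc]].
  - intros x Hx. rewrite Rmin_left, Rmax_right in Hx by lra. apply DM0. lra.
  - intros x Hx. rewrite Rmin_left, Rmax_right in Hx by lra.
    apply continuity_pt_filterlim. apply (ex_derive_continuous (V := R_NormedModule) M).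
    eexists. apply DM. rewrite Rabs_pos_eq; lra.
  - assert (E : M r = M 0) by lra. fold (M r). rewrite E. unfold M.
    rewrite (RInt_ext _ (fun _ => fst (f (RtoC 0)))).
    + rewrite RInt_const. unfold scal; simpl; unfold mult; simpl. ring.
    + intros x _. do 2 f_equal. unfold polar. ring.
Qed.

(** This replaces Cauchy's theorem. With [p = polar r x] one has [dp/dx = i p], and the
    [x]-derivative of [Im (f(t p) p)] equals the [t]-derivative of [Re (f(t p) t p)]. Integration
    over [t] in [[0, 1]] leaves only the endpoint [t = 1]. *)
Lemma radial_primitive_derive (f f' : C -> C) (r theta : R) :
  C1_on unit_disc f f' -> 0 < r < 1 ->
  is_derive (fun x => RInt (fun t => snd (f (RtoC t * polar r x) * polar r x)%C) 0 1) theta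
    (fst (f (polar r theta) * polar r theta)%C).
Proof.
  intros Hf Hr.
  (* The condition [Rabs t < 2 - r] describes an open neighbourhood of [[0, 1]] on which [t * p]
     stays in the disc, because [(2 - r) * r < 1]. *)
  assert (Hdisc : forall x t, Rabs t < 2 - r -> unit_disc (RtoC t * polar r x)).
  { intros x t Ht. unfold unit_disc. rewrite Cmod_mult, Cmod_polar, Cmod_R, (Rabs_pos_eq r) by lra.
    pose proof (Rabs_pos t). nra. }
  (* [K] plays both roles: the angular derivative of the imaginary part and the [t]-derivative of
     the real part. *)
  set (K := fun x t => fst ((f' (RtoC t * polar r x) * (RtoC t * polar r x) + f (RtoC t * polar r x)) * polar r x)%C).
  assert (Dth : forall x t, Rabs t < 2 - r ->
     is_derive (fun u => snd (f (RtoC t * polar r u) * polar r u)%C) x (K x t)).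
  { intros x t Ht. destruct (Hf _ (Hdisc x t Ht)) as [H _].
    assert (H' : cderiv (fun w => f (RtoC t * w) * w)%C (polar r x)
                   ((RtoC t * f' (RtoC t * polar r x)) * polar r x + f (RtoC t * polar r x) * 1)%C).
    { apply (cderiv_mult (fun w => f (RtoC t * w)%C) (fun w => w)); [|apply cderiv_id].
      apply (cderiv_comp f (fun w => RtoC t * w)%C); [exact H|].
      eapply cderiv_eq; [apply (cderiv_mult (fun _ => RtoC t) (fun w => w)); [apply cderiv_const|apply cderiv_id]|]. ring. }
    destruct (is_derive_polar_theta r x) as [A B].
    destruct (cderiv_curve _ (fun u => polar r u) x _ (Ci * polar r x)%C H' A B) as [_ E].
    unfold K.
    match type of E with is_derive _ _ ?e => replace (fst _) with e; [exact E|] end.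
    destruct (f' (RtoC t * polar r x)%C) as [a1 a2], (f (RtoC t * polar r x)%C) as [b1 b2].
    destruct (polar r x) as [p1 p2]. unfold Ci, Cmult, Cplus, RtoC; simpl. ring. }
  assert (Ccurve : forall (U : UniformSpace) (c d : U -> R) (x : U), continuous c x -> continuous d x -> Rabs (d x) < 2 - r ->
     continuous (T := U) (U := C_UniformSpace) (fun y => f (RtoC (d y) * polar r (c y)))%C x /\
     continuous (T := U) (U := C_UniformSpace) (fun y => f' (RtoC (d y) * polar r (c y)))%C x).
  { intros U c d x Hc Hd Hx.
    apply (continuous_disc_curve U unit_disc f f' (fun y => RtoC (d y) * polar r (c y))%C x Hf).
    - apply Hdisc, Hx.
    - apply continuous_Cmult; [apply continuous_RtoC, Hd|apply continuous_polar; [apply continuous_const|exact Hc]]. }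
  assert (CK : forall (U : UniformSpace) (c d : U -> R) (x : U), continuous c x -> continuous d x -> Rabs (d x) < 2 - r ->
     continuous (fun y => K (c y) (d y)) x).
  { intros U c d x Hc Hd Hx. destruct (Ccurve U c d x Hc Hd Hx) as [A B].
    unfold K. apply continuous_fst_C.
    assert (Cp : continuous (T := U) (U := C_UniformSpace) (fun y => polar r (c y)) x)
      by (apply continuous_polar; [apply continuous_const|exact Hc]).
    apply continuous_Cmult; [apply continuous_Cplus; [apply continuous_Cmult|]|]; auto.
    apply continuous_Cmult; auto. apply continuous_RtoC, Hd. }
  replace (fst (f (polar r theta) * polar r theta)%C)
    with (RInt (fun t => Derive (fun u => snd (f (RtoC t * polar r u) * polar r u)%C) theta) 0 1).
  - apply (is_derive_RInt_param (fun x t => snd (f (RtoC t * polar r x) * polar r x)%C) 0 1 theta).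
    + apply filter_forall. intros x t Ht. rewrite Rmin_left, Rmax_right in Ht by lra.
      eexists. apply Dth. rewrite Rabs_pos_eq; lra.
    + intros t Ht. rewrite Rmin_left, Rmax_right in Ht by lra.
      apply continuity_2d_pt_ext_loc with K.
      * exists (mkposreal (1 - r) ltac:(lra)). intros u v Hu Hv. simpl in Hv.
        symmetry. apply is_derive_unique, Dth.
        pose proof (Rabs_triang (v - t) t) as T. replace (v - t + t) with v in T by ring.
        rewrite (Rabs_pos_eq t) in T by lra. lra.
      * apply continuous_2d. apply (CK C_UniformSpace (fun p => fst p) (fun p => snd p) (theta, t)).
        -- apply continuous_pair_fst.
        -- apply continuous_pair_snd.
        -- simpl. rewrite Rabs_pos_eq; lra.
    + apply filter_forall. intros x.
      apply (ex_RInt_continuous (V := R_CompleteNormedModule)). intros t Ht.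
      rewrite Rmin_left, Rmax_right in Ht by lra.
      apply continuous_snd_C, continuous_Cmult; [|apply continuous_const].
      apply (Ccurve R_UniformSpace (fun _ => x) (fun t => t) t).
      * apply continuous_const.
      * apply continuous_id.
      * rewrite Rabs_pos_eq; lra.
  - rewrite (RInt_ext _ (fun t => K theta t)).
    2:{ intros t Ht. rewrite Rmin_left, Rmax_right in Ht by lra. apply is_derive_unique, Dth.
        rewrite Rabs_pos_eq; lra. }
    apply is_RInt_unique.
    set (p := polar r theta) in *.
    replace (fst (f p * p)%C) with (minus (fst (f (RtoC 1 * p) * (RtoC 1 * p))%C) (fst (f (RtoC 0 * p) * (RtoC 0 * p))%C)).
    + apply (is_RInt_derive (fun t => fst (f (RtoC t * p) * (RtoC t * p))%C) (fun t => K theta t)).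
      * intros t Ht. rewrite Rmin_left, Rmax_right in Ht by lra.
        assert (Ht' : Rabs t < 2 - r) by (rewrite Rabs_pos_eq; lra).
        destruct (Hf _ (Hdisc theta t Ht')) as [H _]. fold p in H.
        assert (H' : cderiv (fun w => f w * w)%C (RtoC t * p)%C
                   (f' (RtoC t * p) * (RtoC t * p) + f (RtoC t * p) * 1)%C).
        { apply (cderiv_mult f (fun w => w)); [exact H|apply cderiv_id]. }
        destruct (cderiv_curve _ (fun u => RtoC u * p)%C t _ p H') as [E _].
        -- unfold RtoC; simpl. auto_derive; [exact I|ring].
        -- unfold RtoC; simpl. auto_derive; [exact I|ring].
        -- unfold K. fold p. replace (f' (RtoC t * p) * (RtoC t * p) + f (RtoC t * p))%C
             with (f' (RtoC t * p) * (RtoC t * p) + f (RtoC t * p) * 1)%C by ring. exact E.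
      * intros t Ht. rewrite Rmin_left, Rmax_right in Ht by lra.
        apply (CK R_UniformSpace (fun _ => theta) (fun t => t)).
        -- apply continuous_const.
        -- apply continuous_id.
        -- rewrite Rabs_pos_eq; lra.
    + replace (RtoC 1 * p)%C with p by ring. replace (RtoC 0 * p)%C with (RtoC 0) by ring.
      replace (f (RtoC 0) * RtoC 0)%C with (RtoC 0) by ring. unfold minus, plus, opp; simpl. ring.
Qed.

(** * The Cayley transform and hyperbolic functions *)

Lemma ccont_Cmult (f g : C -> C) (z : C) : ccont f z -> ccont g z -> ccont (fun w => f w * g w)%C z.
Proof. apply (continuous_Cmult C_UniformSpace). Qed.

Lemma ccont_comp (f g : C -> C) (z : C) : ccont f (g z) -> ccont g z -> ccont (fun w => f (g w)) z.
Proof.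
  intros Hf Hg.
  apply (continuous_comp (U := C_UniformSpace) (V := C_UniformSpace) (W := C_UniformSpace) g f); assumption.
Qed.

Lemma C1_const (D : C -> Prop) (c : C) : C1_on D (fun _ => c) (fun _ => RtoC 0).
Proof. intros z _. split; [apply cderiv_const|]. apply (continuous_const (U := C_UniformSpace) (V := C_UniformSpace)). Qed.

Lemma C1_id (D : C -> Prop) : C1_on D (fun z => z) (fun _ => RtoC 1).
Proof. intros z _. split; [apply cderiv_id|]. apply (continuous_const (U := C_UniformSpace) (V := C_UniformSpace)). Qed.

Lemma C1_plus (D : C -> Prop) (f f' g g' : C -> C) :
  C1_on D f f' -> C1_on D g g' -> C1_on D (fun z => f z + g z)%C (fun z => f' z + g' z)%C.
Proof.
  intros Hf Hg z Hz. destruct (Hf z Hz), (Hg z Hz). split; [apply cderiv_plus; auto|].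
  apply (continuous_Cplus C_UniformSpace); auto.
Qed.

Lemma C1_mult (D : C -> Prop) (f f' g g' : C -> C) :
  C1_on D f f' -> C1_on D g g' ->
  C1_on D (fun z => f z * g z)%C (fun z => f' z * g z + f z * g' z)%C.
Proof.
  intros Hf Hg z Hz. destruct (Hf z Hz) as [A A'], (Hg z Hz) as [B B']. split; [apply cderiv_mult; auto|].
  apply (continuous_Cplus C_UniformSpace); apply (continuous_Cmult C_UniformSpace); eauto using cderiv_ccont.
Qed.

Lemma C1_comp (D E : C -> Prop) (f f' g g' : C -> C) :
  C1_on E f f' -> C1_on D g g' -> (forall z, D z -> E (g z)) ->
  C1_on D (fun z => f (g z)) (fun z => g' z * f' (g z))%C.
Proof.
  intros Hf Hg Hm z Hz. destruct (Hg z Hz) as [B B']. destruct (Hf _ (Hm z Hz)) as [A A'].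
  split; [apply cderiv_comp; auto|].
  apply ccont_Cmult; [exact B'|]. apply ccont_comp; eauto using cderiv_ccont.
Qed.

Lemma C1_Cinv : C1_on (fun z => z <> RtoC 0) Cinv (fun z => - / (z * z))%C.
Proof.
  intros z Hz. split; [apply cderiv_Cinv, Hz|].
  eapply cderiv_ccont. apply cderiv_opp. apply (cderiv_inv (fun z => z * z)%C).
  - apply cderiv_mult; apply cderiv_id.
  - apply Cmult_neq_0; auto.
Qed.

Lemma C1_Cexp (D : C -> Prop) : C1_on D Cexp Cexp.
Proof. intros z _. split; [apply cderiv_Cexp|]. eapply cderiv_ccont, cderiv_Cexp. Qed.

Definition cayley (z : C) : C := ((1 + z) * / (1 - z))%C.

Lemma C1_cayley : exists c', C1_on (fun z => z <> RtoC 1) cayley c'.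
Proof.
  eexists. unfold cayley.
  eapply (C1_mult _ (fun z => 1 + z)%C _ (fun z => / (1 - z))%C _).
  - apply C1_plus; [apply C1_const|apply C1_id].
  - eapply (C1_comp _ _ Cinv _ (fun z => 1 - z)%C _).
    + apply C1_Cinv.
    + intros z _. instantiate (1 := fun _ => (0 - 1)%C). split.
      * apply cderiv_minus; [apply cderiv_const|apply cderiv_id].
      * apply (continuous_const (U := C_UniformSpace) (V := C_UniformSpace)).
    + intros z Hz H. apply Hz. replace z with (1 - (1 - z))%C by ring. rewrite H. ring.
Qed.

Lemma unit_disc_neq_1 (z : C) : unit_disc z -> z <> RtoC 1.
Proof. intros Hz ->. unfold unit_disc in Hz. rewrite Cmod_1 in Hz. lra. Qed.

Lemma cayley_0 : cayley 0 = RtoC 1.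
Proof. unfold cayley. field. Qed.

Lemma cayley_re_pos (z : C) : unit_disc z -> 0 < fst (cayley z).
Proof.
  intros Hz. pose proof (unit_disc_neq_1 z Hz) as H1.
  unfold unit_disc in Hz. destruct z as [x y].
  assert (Hq : x * x + y * y < 1).
  { unfold Cmod in Hz; simpl in Hz.
    assert (0 <= x * (x * 1) + y * (y * 1)) by nra.
    apply Rnot_le_lt. intros H'. apply (Rlt_not_le _ _ Hz).
    rewrite <- sqrt_1 at 1. apply sqrt_le_1; lra. }
  assert (Hd : 0 < (1 - x) * (1 - x) + y * y).
  { apply Rnot_le_lt. intros H. apply H1. unfold RtoC. f_equal; nra. }
  unfold cayley, Cmult, Cinv, Cplus, Cminus, Copp, RtoC; simpl.
  match goal with |- 0 < ?e => replace e with ((1 - (x * x + y * y)) / ((1 - x) * (1 - x) + y * y)) end.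
  - apply Rdiv_lt_0_compat; lra.
  - field. repeat split; nra.
Qed.

Lemma cayley_circle (s : R) : sin (s / 2) <> 0 -> cayley (polar 1 s) = (0, cos (s / 2) / sin (s / 2)).
Proof.
  intros Hs. unfold polar.
  replace (cos s) with (1 - 2 * sin (s / 2) * sin (s / 2)) by (replace s with (2 * (s / 2)) at 3 by field; rewrite cos_2a_sin; ring).
  replace (sin s) with (2 * sin (s / 2) * cos (s / 2)) by (replace s with (2 * (s / 2)) at 3 by field; rewrite sin_2a; ring).
  pose proof (sin2_cos2 (s / 2)) as H. unfold Rsqr in H.
  set (a := sin (s / 2)) in *. set (b := cos (s / 2)) in *.
  assert (Hd : 0 < a * a) by nra.
  unfold cayley, Cmult, Cinv, Cplus, Cminus, Copp, RtoC; simpl.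
  assert (Hn : (1 + - (1 * (1 - 2 * a * a) - 0 * (2 * a * b))) * ((1 + - (1 * (1 - 2 * a * a) - 0 * (2 * a * b))) * 1) +
    (0 + - (1 * (2 * a * b) + 0 * (1 - 2 * a * a))) * ((0 + - (1 * (2 * a * b) + 0 * (1 - 2 * a * a))) * 1) = 4 * (a * a)).
  { replace 4 with (4 * (a * a + b * b)) at 1 by lra. ring. }
  rewrite Hn. f_equal.
  - field_simplify_eq; [|assumption]. replace (b ^ 2) with (1 - a ^ 2) by (simpl; lra). ring.
  - field_simplify_eq; [|assumption]. ring.
Qed.

Definition Csinh (z : C) : C := ((Cexp z - Cexp (- z)) * / 2)%C.
Definition Ccosh (z : C) : C := ((Cexp z + Cexp (- z)) * / 2)%C.

Lemma cderiv_Cexp_opp (z : C) : cderiv (fun w => Cexp (- w)) z (- Cexp (- z))%C.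
Proof.
  eapply cderiv_eq; [apply (cderiv_comp Cexp Copp)|].
  - apply cderiv_Cexp.
  - apply cderiv_opp, cderiv_id.
  - ring.
Qed.

Lemma cderiv_Csinh (z : C) : cderiv Csinh z (Ccosh z).
Proof.
  eapply cderiv_eq; [apply (cderiv_mult (fun z => Cexp z - Cexp (- z))%C (fun _ => / 2)%C)|].
  - apply cderiv_minus; [apply cderiv_Cexp|apply cderiv_Cexp_opp].
  - apply cderiv_const.
  - unfold Ccosh. ring.
Qed.

Lemma cderiv_Ccosh (z : C) : cderiv Ccosh z (Csinh z).
Proof.
  eapply cderiv_eq; [apply (cderiv_mult (fun z => Cexp z + Cexp (- z))%C (fun _ => / 2)%C)|].
  - apply cderiv_plus; [apply cderiv_Cexp|apply cderiv_Cexp_opp].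
  - apply cderiv_const.
  - unfold Csinh. ring.
Qed.

Lemma exp_le_compat (x y : R) : x <= y -> exp x <= exp y.
Proof. intros [H| ->]; [apply Rlt_le, exp_increasing, H|lra]. Qed.

Lemma Cmod_Cexp_le (z : C) (x : R) : Cmod z <= x -> Cmod (Cexp z) <= exp x.
Proof.
  intros H. rewrite Cmod_Cexp. apply exp_le_compat.
  pose proof (Rabs_fst_le_Cmod z). pose proof (Rle_abs (fst z)). lra.
Qed.

Lemma Cmod_inv_2 : Cmod (/ 2) = / 2.
Proof. rewrite <- RtoC_inv, Cmod_R, Rabs_pos_eq; lra. Qed.

Lemma Cmod_Csinh_le_exp (z : C) (x : R) : Cmod z <= x -> Cmod (Csinh z) <= exp x.
Proof.
  intros H. unfold Csinh. rewrite Cmod_mult, Cmod_inv_2. unfold Cminus.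
  pose proof (Cmod_triangle (Cexp z) (- Cexp (- z))) as T. rewrite Cmod_opp in T.
  pose proof (Cmod_Cexp_le z x H). pose proof (Cmod_Cexp_le (- z) x ltac:(rewrite Cmod_opp; lra)). lra.
Qed.

Lemma Cmod_Ccosh_le_exp (z : C) (x : R) : Cmod z <= x -> Cmod (Ccosh z) <= exp x.
Proof.
  intros H. unfold Ccosh. rewrite Cmod_mult, Cmod_inv_2.
  pose proof (Cmod_triangle (Cexp z) (Cexp (- z))) as T.
  pose proof (Cmod_Cexp_le z x H). pose proof (Cmod_Cexp_le (- z) x ltac:(rewrite Cmod_opp; lra)). lra.
Qed.

(** The real mean value theorem is applied to the two components, at different intermediate points;
    this costs the factor [2]. *)
Lemma cderiv_mean_value (f f' : C -> C) (a b : C) (M : R) :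
  (forall t, 0 <= t <= 1 -> cderiv f (a + RtoC t * (b - a))%C (f' (a + RtoC t * (b - a))%C)) ->
  (forall t, 0 <= t <= 1 -> Cmod (f' (a + RtoC t * (b - a))%C) <= M) ->
  Cmod (f b - f a) <= 2 * M * Cmod (b - a).
Proof.
  intros Hd Hm.
  set (c := fun t => (a + RtoC t * (b - a))%C) in *.
  assert (D : forall t, 0 <= t <= 1 ->
    is_derive (fun s => fst (f (c s))) t (fst (f' (c t) * (b - a))%C) /\
    is_derive (fun s => snd (f (c s))) t (snd (f' (c t) * (b - a))%C)).
  { intros t Ht. apply (cderiv_curve f c t _ (b - a)%C (Hd t Ht));
    unfold c, RtoC; simpl; (auto_derive; [exact I|ring]). }
  assert (B : forall t, 0 <= t <= 1 -> Cmod (f' (c t) * (b - a)) <= M * Cmod (b - a)).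
  { intros t Ht. rewrite Cmod_mult. apply Rmult_le_compat_r; [apply Cmod_ge_0|apply Hm, Ht]. }
  assert (E0 : c 0 = a) by (unfold c; ring). assert (E1 : c 1 = b) by (unfold c; ring).
  destruct (MVT_gen (fun s => fst (f (c s))) 0 1 (fun t => fst (f' (c t) * (b - a))%C)) as [t1 [Ht1 H1]].
  { intros x Hx. rewrite Rmin_left, Rmax_right in Hx by lra. apply (proj1 (D x ltac:(lra))). }
  { intros x Hx. rewrite Rmin_left, Rmax_right in Hx by lra.
    apply continuity_pt_filterlim, (ex_derive_continuous (V := R_NormedModule) (fun s => fst (f (c s)))).
    eexists. exact (proj1 (D x Hx)). }
  destruct (MVT_gen (fun s => snd (f (c s))) 0 1 (fun t => snd (f' (c t) * (b - a))%C)) as [t2 [Ht2 H2]].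
  { intros x Hx. rewrite Rmin_left, Rmax_right in Hx by lra. apply (proj2 (D x ltac:(lra))). }
  { intros x Hx. rewrite Rmin_left, Rmax_right in Hx by lra.
    apply continuity_pt_filterlim, (ex_derive_continuous (V := R_NormedModule) (fun s => snd (f (c s)))).
    eexists. exact (proj2 (D x Hx)). }
  rewrite Rmin_left, Rmax_right in Ht1, Ht2 by lra.
  rewrite E0, E1, Rminus_0_r, Rmult_1_r in H1, H2.
  eapply Rle_trans; [apply Cmod_le_sum|].
  replace (fst (f b - f a)%C) with (fst (f' (c t1) * (b - a))%C) by (rewrite <- H1; simpl; ring).
  replace (snd (f b - f a)%C) with (snd (f' (c t2) * (b - a))%C) by (rewrite <- H2; simpl; ring).
  pose proof (Rabs_fst_le_Cmod (f' (c t1) * (b - a))%C). pose proof (Rabs_snd_le_Cmod (f' (c t2) * (b - a))%C).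
  pose proof (B t1 Ht1). pose proof (B t2 Ht2). lra.
Qed.

Lemma Csinh_0 : Csinh 0 = RtoC 0.
Proof. unfold Csinh. replace (- 0)%C with (RtoC 0) by ring. ring. Qed.

Lemma Cmod_Csinh_le (z : C) (x : R) : Cmod z <= x -> Cmod (Csinh z) <= 2 * x * exp x.
Proof.
  intros H. replace (Csinh z) with (Csinh z - Csinh 0)%C by (rewrite Csinh_0; ring).
  eapply Rle_trans; [apply (cderiv_mean_value Csinh Ccosh 0 z (exp x))|].
  - intros t _. apply cderiv_Csinh.
  - intros t Ht. apply Cmod_Ccosh_le_exp.
    replace (0 + RtoC t * (z - 0))%C with (RtoC t * z)%C by ring.
    rewrite Cmod_mult, Cmod_R, Rabs_pos_eq by lra. pose proof (Cmod_ge_0 z). nra.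
  - replace (z - 0)%C with z by ring. pose proof (exp_pos x). nra.
Qed.

(** * Series of holomorphic functions *)

Lemma Series_nonneg (a : nat -> R) : (forall k, 0 <= a k) -> ex_series a -> 0 <= Series a.
Proof.
  intros H Ha. replace 0 with (Series (fun k => 0 * a k)) by (rewrite Series_scal_l; ring).
  apply Series_le; [|exact Ha]. intros k. specialize (H k). lra.
Qed.

Definition CSeries (a : nat -> C) : C := (Series (fun k => fst (a k)), Series (fun k => snd (a k))).

Definition Csummable (a : nat -> C) : Prop := ex_series (fun k => Cmod (a k)).

Lemma Csummable_le (a : nat -> C) (M : nat -> R) :
  (forall k, Cmod (a k) <= M k) -> ex_series M -> Csummable a.
Proof.
  intros H HM. apply (ex_series_le (V := R_CompleteNormedModule) _ M); [|exact HM].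
  intros k. change (Rabs (Cmod (a k)) <= M k). rewrite Rabs_pos_eq by apply Cmod_ge_0. apply H.
Qed.

Lemma Csummable_re_im (a : nat -> C) :
  Csummable a ->
  ex_series (fun k => Rabs (fst (a k))) /\ ex_series (fun k => Rabs (snd (a k))).
Proof.
  intros H. split; apply (ex_series_le (V := R_CompleteNormedModule) _ (fun k => Cmod (a k))); try exact H;
  intros k; [change (Rabs (Rabs (fst (a k))) <= Cmod (a k))|change (Rabs (Rabs (snd (a k))) <= Cmod (a k))];
  rewrite Rabs_Rabsolu; [apply Rabs_fst_le_Cmod|apply Rabs_snd_le_Cmod].
Qed.

(** The factor [2] comes from bounding the real and imaginary sums separately. *)
Lemma Cmod_CSeries_le (a : nat -> C) (M : nat -> R) :
  (forall k, Cmod (a k) <= M k) -> ex_series M -> Cmod (CSeries a) <= 2 * Series M.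
Proof.
  intros H HM. destruct (Csummable_re_im a (Csummable_le a M H HM)) as [A B].
  eapply Rle_trans; [apply Cmod_le_sum|]. unfold CSeries. cbn [fst snd].
  assert (Rabs (Series (fun k => fst (a k))) <= Series M).
  { eapply Rle_trans; [apply Series_Rabs, A|]. apply Series_le; [|exact HM].
    intros k. split; [apply Rabs_pos|]. eapply Rle_trans; [apply Rabs_fst_le_Cmod|apply H]. }
  assert (Rabs (Series (fun k => snd (a k))) <= Series M).
  { eapply Rle_trans; [apply Series_Rabs, B|]. apply Series_le; [|exact HM].
    intros k. split; [apply Rabs_pos|]. eapply Rle_trans; [apply Rabs_snd_le_Cmod|apply H]. }
  lra.
Qed.

Lemma CSeries_minus (a b : nat -> C) :
  Csummable a -> Csummable b -> CSeries (fun k => a k - b k)%C = (CSeries a - CSeries b)%C.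
Proof.
  intros Ha Hb. apply Csummable_re_im in Ha, Hb. destruct Ha as [A1 A2], Hb as [B1 B2].
  apply ex_series_Rabs in A1, A2, B1, B2.
  unfold CSeries, Cminus, Cplus, Copp; simpl.
  f_equal; apply Series_minus; assumption.
Qed.

Lemma CSeries_scal (c : C) (a : nat -> C) :
  Csummable a -> CSeries (fun k => c * a k)%C = (c * CSeries a)%C.
Proof.
  intros Ha. apply Csummable_re_im in Ha. destruct Ha as [A1 A2].
  apply ex_series_Rabs in A1, A2.
  unfold CSeries, Cmult; simpl.
  rewrite Series_minus, Series_plus by (apply (ex_series_scal (V := R_NormedModule)); assumption).
  rewrite !Series_scal_l. reflexivity.
Qed.

Lemma Csummable_minus (a b : nat -> C) :
  Csummable a -> Csummable b -> Csummable (fun k => a k - b k)%C.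
Proof.
  intros Ha Hb. apply (Csummable_le _ (fun k => Cmod (a k) + Cmod (b k))).
  - intros k. eapply Rle_trans; [apply Cmod_triangle|]. rewrite Cmod_opp. lra.
  - apply (ex_series_plus (K := R_AbsRing) (V := R_NormedModule)); assumption.
Qed.

Lemma Csummable_scal (c : C) (a : nat -> C) : Csummable a -> Csummable (fun k => c * a k)%C.
Proof.
  intros Ha. apply (Csummable_le _ (fun k => Cmod c * Cmod (a k))).
  - intros k. rewrite Cmod_mult. lra.
  - apply (ex_series_scal (V := R_NormedModule)); assumption.
Qed.

Lemma Cmod_segment_le (a b : C) (t x : R) :
  0 <= t <= 1 -> Cmod a <= x -> Cmod b <= x -> Cmod (a + RtoC t * (b - a)) <= x.
Proof.
  intros Ht Ha Hb. replace (a + RtoC t * (b - a))%C with (RtoC (1 - t) * a + RtoC t * b)%C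
    by (rewrite RtoC_minus; ring).
  eapply Rle_trans; [apply Cmod_triangle|]. rewrite !Cmod_mult, !Cmod_R, !Rabs_pos_eq by lra. nra.
Qed.

(* The second derivatives control the Taylor remainders of all the terms at once. *)
Lemma CSeries_C1 (f f1 f2 : nat -> C -> C) :
  (forall k z, cderiv (f k) z (f1 k z)) ->
  (forall k z, cderiv (f1 k) z (f2 k z)) ->
  (forall x, exists M, ex_series M /\
     forall k z, Cmod z <= x -> Cmod (f k z) <= M k /\ Cmod (f1 k z) <= M k /\ Cmod (f2 k z) <= M k) ->
  C1_on (fun _ => True) (fun z => CSeries (fun k => f k z)) (fun z => CSeries (fun k => f1 k z)).
Proof.
  intros Df Df1 Hbound z _. destruct (Hbound (Cmod z + 1)) as [M [HM HB]].
  assert (HM0 : 0 <= Series M).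
  { apply Series_nonneg; [|exact HM]. intros k. eapply Rle_trans; [apply Cmod_ge_0|]. apply (HB k z). lra. }
  assert (S0 : forall w, Cmod w <= Cmod z + 1 -> Csummable (fun k => f k w) /\ Csummable (fun k => f1 k w)).
  { intros w Hw. split; apply (Csummable_le _ M); auto; intros k; apply (HB k w Hw). }
  assert (Hz : Cmod z <= Cmod z + 1) by lra.
  assert (Hy : forall y, Cmod (y - z) < 1 -> Cmod y <= Cmod z + 1).
  { intros y Hy. replace y with (z + (y - z))%C by ring. eapply Rle_trans; [apply Cmod_triangle|]. lra. }
  assert (B1 : forall k a b, Cmod a <= Cmod z + 1 -> Cmod b <= Cmod z + 1 ->
             Cmod (f1 k b - f1 k a) <= 2 * M k * Cmod (b - a)).
  { intros k a b Ha Hb. apply (cderiv_mean_value (f1 k) (f2 k)).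
    - intros t _. apply Df1.
    - intros t Ht. apply (HB k). apply Cmod_segment_le; auto. }
  assert (HMs : forall c, ex_series (fun k => M k * c)) by (intros c; apply ex_series_scal_r; exact HM).
  split.
  - apply cderiv_eps. intros eps He.
    exists (Rmin 1 (eps / (8 * (Series M + 1)))).
    split; [apply Rmin_pos; [lra|apply Rdiv_lt_0_compat; lra]|].
    intros y Hd.
    assert (Hd1 := Rlt_le_trans _ _ _ Hd (Rmin_l _ _)).
    assert (Hd2 := Rlt_le_trans _ _ _ Hd (Rmin_r _ _)). clear Hd.
    destruct (S0 z Hz) as [Sz Sz1]. destruct (S0 y (Hy y Hd1)) as [Sy Sy1].
    rewrite <- CSeries_scal, <- !CSeries_minus by auto using Csummable_minus, Csummable_scal.
    assert (Hd : 0 <= Cmod (y - z)) by apply Cmod_ge_0.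
    eapply Rle_trans.
    + apply (Cmod_CSeries_le _ (fun k => M k * (4 * Cmod (y - z) * Cmod (y - z)))); [|apply HMs].
      intros k.
      (* The mean value inequality is used twice: the derivative [f1 k w - f1 k z] of the auxiliary
         function is itself [O(Cmod (w - z))], so the Taylor remainder is at most [4 * M k] times
         the square of [Cmod (y - z)]. *)
      pose proof (cderiv_mean_value (fun w => f k w - (w - z) * f1 k z)%C (fun w => f1 k w - f1 k z)%C z y
        (2 * M k * Cmod (y - z))) as T.
      replace (f k y - f k z - (y - z) * f1 k z)%C
        with (f k y - (y - z) * f1 k z - (f k z - (z - z) * f1 k z))%C by ring.
      eapply Rle_trans; [apply T|].
      * intros t Ht. set (w := (z + RtoC t * (y - z))%C). eapply cderiv_eq.
        { apply cderiv_minus; [apply Df|].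
          apply (cderiv_mult (fun w => w - z)%C (fun _ => f1 k z)); [|apply cderiv_const].
          apply cderiv_minus; [apply cderiv_id|apply cderiv_const]. }
        ring.
      * intros t Ht.
        assert (Hw : Cmod (z + RtoC t * (y - z)) <= Cmod z + 1) by (apply Cmod_segment_le; auto).
        eapply Rle_trans; [apply B1; auto|].
        replace (z + RtoC t * (y - z) - z)%C with (RtoC t * (y - z))%C by ring.
        rewrite Cmod_mult, Cmod_R, Rabs_pos_eq by lra.
        assert (0 <= M k) by (eapply Rle_trans; [apply Cmod_ge_0|apply (HB k z Hz)]).
        apply Rmult_le_compat_l; [lra|]. nra.
      * right. ring.
    + rewrite Series_scal_r.
      apply (Rmult_lt_compat_r (8 * (Series M + 1))) in Hd2; [|lra].
      replace (eps / (8 * (Series M + 1)) * (8 * (Series M + 1))) with eps in Hd2 by (field; lra).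
      replace (2 * (Series M * (4 * Cmod (y - z) * Cmod (y - z))))
        with ((Cmod (y - z) * (8 * Series M)) * Cmod (y - z)) by ring.
      apply Rmult_le_compat_r; [exact Hd|]. nra.
  - apply ccont_eps. intros eps He.
    exists (Rmin 1 (eps / (4 * (Series M + 1)))).
    split; [apply Rmin_pos; [lra|apply Rdiv_lt_0_compat; lra]|].
    intros y Hd.
    assert (Hd1 := Rlt_le_trans _ _ _ Hd (Rmin_l _ _)).
    assert (Hd2 := Rlt_le_trans _ _ _ Hd (Rmin_r _ _)). clear Hd.
    destruct (S0 z Hz) as [Sz Sz1]. destruct (S0 y (Hy y Hd1)) as [Sy Sy1].
    rewrite <- CSeries_minus by auto.
    assert (Hd : 0 <= Cmod (y - z)) by apply Cmod_ge_0.
    eapply Rle_lt_trans.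
    + apply (Cmod_CSeries_le _ (fun k => M k * (2 * Cmod (y - z)))); [|apply HMs].
      intros k. eapply Rle_trans; [apply B1; auto|]. right; ring.
    + rewrite Series_scal_r.
      apply (Rmult_lt_compat_r (4 * (Series M + 1))) in Hd2; [|lra].
      replace (eps / (4 * (Series M + 1)) * (4 * (Series M + 1))) with eps in Hd2 by (field; lra).
      nra.
Qed.

(** * The function [spiky] *)

Definition eta (k : nat) : R := / sqrt (INR (S k)).
Definition freq (k : nat) : nat := (8 * 4 ^ k)%nat.
Definition scaled (k : nat) (w : C) : C := (w * RtoC (/ INR (freq k)))%C.
Definition base (k : nat) (w : C) : C := (RtoC (1 + eta k ^ 2) * Csinh (scaled k w))%C.
Definition term (k : nat) (w : C) : C := (RtoC ((/ 2) ^ k) * base k w ^ freq k)%C.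

Lemma eta_pos (k : nat) : 0 < eta k.
Proof. apply Rinv_0_lt_compat, sqrt_lt_R0, lt_0_INR. lia. Qed.

Lemma eta_sqr (k : nat) : eta k ^ 2 = / INR (S k).
Proof.
  unfold eta. rewrite pow_inv. f_equal. simpl (_ ^ 2). rewrite Rmult_1_r.
  apply sqrt_sqrt, pos_INR.
Qed.

Lemma eta_le_1 (k : nat) : eta k <= 1.
Proof.
  unfold eta. rewrite <- Rinv_1. apply Rinv_le_contravar; [lra|].
  rewrite <- sqrt_1. apply sqrt_le_1; [lra|apply pos_INR|].
  rewrite S_INR. pose proof (pos_INR k). lra.
Qed.

Lemma freq_pow (k : nat) : INR (freq k) = 8 * 4 ^ k.
Proof. unfold freq. rewrite mult_INR, pow_INR, !INR_IZR_INZ. reflexivity. Qed.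

Lemma freq_pos (k : nat) : 0 < INR (freq k).
Proof. rewrite freq_pow. pose proof (pow_lt 4 k ltac:(lra)). lra. Qed.

Lemma freq_ge_8 (k : nat) : 8 <= INR (freq k).
Proof. rewrite freq_pow. pose proof (pow_R1_Rle 4 k ltac:(lra)). lra. Qed.

Lemma Cmod_scaled (k : nat) (w : C) (x : R) : Cmod w <= x -> Cmod (scaled k w) <= x / INR (freq k).
Proof.
  intros H. pose proof (Rinv_0_lt_compat _ (freq_pos k)) as P.
  unfold scaled, Rdiv. rewrite Cmod_mult, Cmod_R, Rabs_pos_eq by lra.
  apply Rmult_le_compat_r; lra.
Qed.

Lemma amplitude_bounds (k : nat) : 1 < 1 + eta k ^ 2 <= 2.
Proof. pose proof (eta_pos k). pose proof (eta_le_1 k). simpl. split; nra. Qed.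

Lemma Cmod_base_le (k : nat) (w : C) (x : R) :
  Cmod w <= x -> Cmod (base k w) <= 4 * (x / INR (freq k)) * exp (x / INR (freq k)).
Proof.
  intros H. unfold base. pose proof (amplitude_bounds k) as B.
  rewrite Cmod_mult, Cmod_R, Rabs_pos_eq by lra.
  pose proof (Cmod_Csinh_le _ _ (Cmod_scaled k w x H)) as S.
  pose proof (Cmod_ge_0 (Csinh (scaled k w))). nra.
Qed.

Lemma exp_pow (x : R) (n : nat) : exp x ^ n = exp (INR n * x).
Proof.
  induction n as [|n IH]; [simpl; rewrite Rmult_0_l, exp_0; reflexivity|].
  rewrite <- tech_pow_Rmult, IH, S_INR, <- exp_plus. f_equal. ring.
Qed.

(** With [u = x / freq k], the inequality [4 u <= exp (4 u)] bounds the base by [exp (5 u)]; raising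
    to a power at most [freq k] cancels the denominator, so the bound does not depend on [k]. *)
Lemma Cmod_base_pow_le (k m : nat) (w : C) (x : R) :
  Cmod w <= x -> (m <= freq k)%nat -> Cmod (base k w) ^ m <= exp (5 * x).
Proof.
  intros H Hm. pose proof (freq_pos k) as P.
  assert (Hx : 0 <= x) by (pose proof (Cmod_ge_0 w); lra).
  apply Rle_trans with (exp (5 * (x / INR (freq k))) ^ m).
  - apply pow_incr. split; [apply Cmod_ge_0|].
    eapply Rle_trans; [apply Cmod_base_le, H|].
    set (u := x / INR (freq k)).
    replace (5 * u) with (4 * u + u) by ring. rewrite exp_plus.
    apply Rmult_le_compat_r; [apply Rlt_le, exp_pos|].
    pose proof (exp_ineq1_le (4 * u)). lra.
  - rewrite exp_pow. apply exp_le_compat.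
    apply le_INR in Hm.
    replace (5 * x) with (INR (freq k) * (5 * (x / INR (freq k)))) by (field; lra).
    apply Rmult_le_compat_r; [|exact Hm].
    apply Rmult_le_pos; [lra|]. apply Rmult_le_pos; [lra|]. apply Rlt_le, Rinv_0_lt_compat, P.
Qed.

(** In both derivatives the factor [freq k] produced by the power is already cancelled against the
    inner derivative [/ freq k], so that only ratios at most [1] remain. *)
Definition term' (k : nat) (w : C) : C :=
  (RtoC ((/ 2) ^ k * (1 + eta k ^ 2)) * (Ccosh (scaled k w) * base k w ^ pred (freq k)))%C.
Definition term'' (k : nat) (w : C) : C :=
  (RtoC ((/ 2) ^ k * (1 + eta k ^ 2)) *
    (Csinh (scaled k w) * RtoC (/ INR (freq k)) * base k w ^ pred (freq k) +
     Ccosh (scaled k w) *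
       (RtoC (INR (pred (freq k)) * / INR (freq k) * (1 + eta k ^ 2)) *
         Ccosh (scaled k w) * base k w ^ pred (pred (freq k)))))%C.

Lemma cderiv_scaled (k : nat) (w : C) : cderiv (scaled k) w (RtoC (/ INR (freq k))).
Proof.
  eapply cderiv_eq; [apply (cderiv_mult (fun w => w) (fun _ => RtoC (/ INR (freq k)))); [apply cderiv_id|apply cderiv_const]|]. ring.
Qed.

Lemma cderiv_base (k : nat) (w : C) :
  cderiv (base k) w (RtoC (1 + eta k ^ 2) * (RtoC (/ INR (freq k)) * Ccosh (scaled k w)))%C.
Proof.
  eapply cderiv_eq.
  - apply (cderiv_mult (fun _ => RtoC (1 + eta k ^ 2)) (fun w => Csinh (scaled k w))); [apply cderiv_const|].
    apply (cderiv_comp Csinh (scaled k)); [apply cderiv_Csinh|apply cderiv_scaled].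
  - ring.
Qed.

Lemma cderiv_term (k : nat) (w : C) : cderiv (term k) w (term' k w).
Proof.
  eapply cderiv_eq.
  - apply (cderiv_mult (fun _ => RtoC ((/ 2) ^ k)) (fun w => base k w ^ freq k)%C); [apply cderiv_const|].
    apply cderiv_pow, cderiv_base.
  - unfold term'. rewrite RtoC_mult.
    assert (E : (RtoC (INR (freq k)) * RtoC (/ INR (freq k)))%C = RtoC 1).
    { rewrite <- RtoC_mult, Rinv_r; [reflexivity|]. pose proof (freq_pos k). lra. }
    transitivity (RtoC ((/ 2) ^ k) * RtoC (1 + eta k ^ 2) *
       (RtoC (INR (freq k)) * RtoC (/ INR (freq k))) * (Ccosh (scaled k w) * base k w ^ pred (freq k)))%C.
    + ring.
    + rewrite E. ring.
Qed.

Lemma cderiv_term' (k : nat) (w : C) : cderiv (term' k) w (term'' k w).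
Proof.
  eapply cderiv_eq.
  - apply (cderiv_mult (fun _ => RtoC ((/ 2) ^ k * (1 + eta k ^ 2)))
             (fun w => Ccosh (scaled k w) * base k w ^ pred (freq k))%C); [apply cderiv_const|].
    apply (cderiv_mult (fun w => Ccosh (scaled k w)) (fun w => base k w ^ pred (freq k))%C).
    + apply (cderiv_comp Ccosh (scaled k)); [apply cderiv_Ccosh|apply cderiv_scaled].
    + apply cderiv_pow, cderiv_base.
  - unfold term''. rewrite !RtoC_mult. ring.
Qed.

(** In the exponent, [5 x] comes from the power of [base] and [x] from the hyperbolic factors. The
    constant [6] is the amplitude bound [2] times [3], the sum of the bounds [1] and [2] for the two
    summands of [term'']. *)
Lemma term_bounds (k : nat) (w : C) (x : R) :
  Cmod w <= x ->
  Cmod (term k w) <= 6 * exp (6 * x) * (/ 2) ^ k /\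
  Cmod (term' k w) <= 6 * exp (6 * x) * (/ 2) ^ k /\
  Cmod (term'' k w) <= 6 * exp (6 * x) * (/ 2) ^ k.
Proof.
  intros H. pose proof (amplitude_bounds k) as A.
  assert (Hx : 0 <= x) by (pose proof (Cmod_ge_0 w); lra).
  pose proof (pow_lt (/ 2) k ltac:(lra)) as P.
  pose proof (freq_ge_8 k) as N8.
  assert (Hi : 0 < / INR (freq k) <= 1).
  { split; [apply Rinv_0_lt_compat; lra|]. rewrite <- Rinv_1. apply Rinv_le_contravar; lra. }
  assert (Hs : Cmod (scaled k w) <= x).
  { eapply Rle_trans; [apply Cmod_scaled, H|]. unfold Rdiv. nra. }
  pose proof (Cmod_Csinh_le_exp _ _ Hs) as S. pose proof (Cmod_Ccosh_le_exp _ _ Hs) as Ch.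
  (* Two hyperbolic cosines occur here. Each is estimated by [exp (x / freq k)] rather than by
     [exp x], so that their product still fits into [exp x]. *)
  assert (Hch : Cmod (Ccosh (scaled k w)) * Cmod (Ccosh (scaled k w)) * Cmod (base k w) ^ pred (pred (freq k))
             <= exp (6 * x)).
  { destruct (Nat.le_exists_sub 2 (freq k)) as [n [Hn _]].
    { apply INR_le. simpl (INR 2). lra. }
    assert (Hu : exp (x / INR (freq k)) * exp (x / INR (freq k)) <= exp x).
    { rewrite <- exp_plus. apply exp_le_compat. unfold Rdiv.
      assert (/ INR (freq k) <= / 2) by (apply Rinv_le_contravar; lra). nra. }
    pose proof (Cmod_Ccosh_le_exp _ _ (Cmod_scaled k w x H)) as C'.
    pose proof (Cmod_ge_0 (Ccosh (scaled k w))).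
    pose proof (Cmod_base_pow_le k (pred (pred (freq k))) w x H ltac:(lia)) as B.
    replace (6 * x) with (x + 5 * x) by ring. rewrite exp_plus.
    apply Rmult_le_compat; auto.
    - nra.
    - apply pow_le, Cmod_ge_0.
    - eapply Rle_trans; [|exact Hu]. apply Rmult_le_compat; auto. }
  assert (E6 : exp (6 * x) = exp x * exp (5 * x)) by (rewrite <- exp_plus; f_equal; ring).
  pose proof (Cmod_base_pow_le k (freq k) w x H ltac:(lia)) as B0.
  pose proof (Cmod_base_pow_le k (pred (freq k)) w x H ltac:(lia)) as B1.
  assert (Ex1 : 1 <= exp x) by (rewrite <- exp_0; apply exp_le_compat; lra).
  pose proof (exp_pos (5 * x)) as E5.
  assert (Hb1 : 0 <= Cmod (base k w) ^ pred (freq k)) by (apply pow_le, Cmod_ge_0).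
  assert (Hb2 : 0 <= Cmod (base k w) ^ pred (pred (freq k))) by (apply pow_le, Cmod_ge_0).
  pose proof (Cmod_ge_0 (Ccosh (scaled k w))) as Q1. pose proof (Cmod_ge_0 (Csinh (scaled k w))) as Q2.
  assert (T1 : Cmod (Ccosh (scaled k w)) * Cmod (base k w) ^ pred (freq k) <= exp (6 * x)).
  { rewrite E6. apply Rmult_le_compat; auto. }
  assert (T2 : Cmod (Csinh (scaled k w)) * / INR (freq k) * Cmod (base k w) ^ pred (freq k) <= exp (6 * x)).
  { rewrite E6. apply Rmult_le_compat; auto; nra. }
  assert (E60 : 0 < exp (6 * x)) by apply exp_pos.
  split; [|split].
  - unfold term. rewrite Cmod_mult, Cmod_R, Cmod_pow, Rabs_pos_eq by lra.
    rewrite Rmult_comm. apply Rmult_le_compat_r; [lra|]. nra.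
  - unfold term'. rewrite !Cmod_mult, Cmod_R, Cmod_pow, Rabs_pos_eq by nra.
    apply Rle_trans with ((/ 2) ^ k * 2 * exp (6 * x)); [|nra].
    apply Rmult_le_compat; [nra| |nra|exact T1]. apply Rmult_le_pos; auto.
  - unfold term''. rewrite Cmod_mult, Cmod_R, Rabs_pos_eq by nra.
    apply Rle_trans with ((/ 2) ^ k * 2 * (3 * exp (6 * x))); [|nra].
    apply Rmult_le_compat; [nra|apply Cmod_ge_0|nra|].
    eapply Rle_trans; [apply Cmod_triangle|]. rewrite !Cmod_mult, !Cmod_R, !Cmod_pow.
    rewrite (Rabs_pos_eq (/ INR (freq k))) by lra.
    assert (Hq : 0 <= INR (pred (freq k)) * / INR (freq k) * (1 + eta k ^ 2) <= 2).
    { assert (0 <= INR (pred (freq k)) * / INR (freq k) <= 1); [|split; nra].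
      pose proof (pos_INR (pred (freq k))).
      assert (INR (pred (freq k)) <= INR (freq k)) by (apply le_INR; lia).
      split; [apply Rmult_le_pos; lra|].
      apply Rmult_le_reg_r with (INR (freq k)); [lra|]. rewrite Rmult_assoc, Rinv_l; lra. }
    rewrite Rabs_pos_eq by lra.
    set (q := INR (pred (freq k)) * / INR (freq k) * (1 + eta k ^ 2)) in *.
    assert (T3 : Cmod (Ccosh (scaled k w)) * (q * Cmod (Ccosh (scaled k w)) * Cmod (base k w) ^ pred (pred (freq k)))
       <= 2 * exp (6 * x)).
    { replace (Cmod (Ccosh (scaled k w)) * (q * Cmod (Ccosh (scaled k w)) * Cmod (base k w) ^ pred (pred (freq k))))
        with (q * (Cmod (Ccosh (scaled k w)) * Cmod (Ccosh (scaled k w)) * Cmod (base k w) ^ pred (pred (freq k)))) by ring.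
      apply Rmult_le_compat; [lra| |lra|exact Hch]. apply Rmult_le_pos; auto. apply Rmult_le_pos; auto. }
    lra.
Qed.

Lemma ex_series_half (c : R) : ex_series (fun k => c * (/ 2) ^ k).
Proof.
  apply (ex_series_scal (V := R_NormedModule)). apply ex_series_geom. rewrite Rabs_pos_eq; lra.
Qed.

Lemma Series_half (c : R) : Series (fun k => c * (/ 2) ^ k) = 2 * c.
Proof. rewrite Series_scal_l, Series_geom by (rewrite Rabs_pos_eq; lra). field. Qed.

Definition spiky (w : C) : C := CSeries (fun k => term k w).

Lemma C1_spiky : exists s', C1_on (fun _ => True) spiky s'.
Proof.
  eexists. apply (CSeries_C1 term term' term'').
  - apply cderiv_term.
  - apply cderiv_term'.
  - intros x. exists (fun k => 6 * exp (6 * x) * (/ 2) ^ k). split; [apply ex_series_half|].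
    intros k w Hw. apply term_bounds, Hw.
Qed.

Definition counterexample (z : C) : C := spiky (cayley z).

(** [spiky] is entire and the Cayley transform is regular off [1], so the function is regular beyond
    the disc, at every point of the unit circle other than [1]. The lower bounds for the primitive
    start from those boundary values. *)
Lemma C1_counterexample : exists c', C1_on (fun z => z <> RtoC 1) counterexample c'.
Proof.
  destruct C1_spiky as [s' Hs]. destruct C1_cayley as [c' Hc].
  eexists. apply (C1_comp _ _ spiky s' cayley c' Hs Hc). auto.
Qed.

(** * Harmonic majorants *)

(** A Moebius map with its pole at [-(1 + eta)], just outside the disc. Its real part, nonnegative
    on the disc, imitates a Poisson kernel concentrated at [-1] on the scale [eta]; its zero at [1]
    makes the majorants small at [w = 1]. *)
Definition bump (eta : R) (zeta : C) : C := ((1 - zeta) * / (RtoC (1 + eta) + zeta))%C.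

Lemma Cmod_sqr_re_im (z : C) : Cmod z ^ 2 = fst z ^ 2 + snd z ^ 2.
Proof. unfold Cmod. rewrite pow2_sqrt; [reflexivity|]. pose proof (pow2_ge_0 (fst z)). pose proof (pow2_ge_0 (snd z)). lra. Qed.

Lemma bump_re (eta a b : R) : 0 < (1 + eta + a) ^ 2 + b ^ 2 ->
  fst (bump eta (a, b)) = (1 + eta - eta * a - (a ^ 2 + b ^ 2)) / ((1 + eta + a) ^ 2 + b ^ 2).
Proof.
  intros H. unfold bump, Cmult, Cinv, Cplus, Cminus, Copp, RtoC; simpl. simpl in H.
  field. intros E. simpl in *. lra.
Qed.

(* Near [zeta = -1] the real part of [bump] is of order [1 / eta], and only there can the left side exceed [1]. *)
Lemma bump_majorant (eta : R) (zeta : C) :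
  0 < eta <= 1 -> Cmod zeta <= 1 ->
  0 <= fst (bump eta zeta) /\
  Cmod (RtoC (1 + eta ^ 2) * ((1 - zeta) * / 2)) <= exp (40 * eta ^ 3 * fst (bump eta zeta)).
Proof.
  intros He Hz. pose proof (Cmod_ge_0 zeta) as Hz0.
  assert (Hq : Cmod zeta ^ 2 <= 1) by (simpl; nra). rewrite Cmod_sqr_re_im in Hq.
  pose proof (Rabs_fst_le_Cmod zeta) as Ha. apply Rabs_le_between in Ha.
  assert (Hmod : Cmod (1 - zeta) ^ 2 = (1 - fst zeta) ^ 2 + snd zeta ^ 2).
  { rewrite Cmod_sqr_re_im. simpl. ring. }
  assert (H2 : Cmod (1 - zeta) <= 2).
  { unfold Cminus. eapply Rle_trans; [apply Cmod_triangle|]. rewrite Cmod_opp, Cmod_1. lra. }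
  pose proof (Cmod_ge_0 (1 - zeta)) as Hm0.
  rewrite !Cmod_mult, Cmod_R, Cmod_inv_2, Rabs_pos_eq by nra.
  set (m := Cmod (1 - zeta)) in *.
  destruct zeta as [a b]. cbn [fst snd] in Hq, Ha, Hmod.
  assert (Hden : 0 < (1 + eta + a) ^ 2 + b ^ 2) by (pose proof (pow2_ge_0 b); nra).
  rewrite bump_re by exact Hden.
  set (den := (1 + eta + a) ^ 2 + b ^ 2) in *.
  assert (Hnum : eta * (1 - a) <= 1 + eta - eta * a - (a ^ 2 + b ^ 2)) by lra.
  assert (Hpos : 0 <= (1 + eta - eta * a - (a ^ 2 + b ^ 2)) / den).
  { apply Rmult_le_pos; [nra|]. apply Rlt_le, Rinv_0_lt_compat, Hden. }
  split; [exact Hpos|].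
  set (v := (1 + eta - eta * a - (a ^ 2 + b ^ 2)) / den) in *.
  assert (He3 : 0 < eta ^ 3) by (apply pow_lt; lra).
  destruct (Rle_lt_dec ((1 + eta ^ 2) * (m * / 2)) 1) as [Hs|Hs].
  { eapply Rle_trans; [exact Hs|]. rewrite <- exp_0. apply exp_le_compat.
    apply Rmult_le_pos; lra. }
  (* If the left side exceeds [1], then [4 - m^2 <= 12 eta^2], and the parallelogram law gives the
     same bound for the squared modulus of [1 + zeta]. Hence [1 + a <= 7/2 eta] and
     [den <= (12 + 7 + 1) eta^2], while the numerator is at least [eta / 2]. The constant [40] is
     chosen so that [40 eta^3 v >= eta^2], which dominates [ln (1 + eta^2)]. *)
  assert (Hv : / (40 * eta) <= v).
  { assert (Hsq : 1 < ((1 + eta ^ 2) * (m * / 2)) ^ 2) by (simpl; nra).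
    assert (Hsq' : 4 < (1 + eta ^ 2) ^ 2 * m ^ 2).
    { replace ((1 + eta ^ 2) ^ 2 * m ^ 2) with (4 * ((1 + eta ^ 2) * (m * / 2)) ^ 2) by field. lra. }
    assert (Hm4 : m ^ 2 <= 4) by (simpl; nra).
    assert (Hm2 : 4 - m ^ 2 <= 12 * eta ^ 2).
    { assert (eta ^ 4 <= eta ^ 2) by (replace (eta ^ 4) with (eta ^ 2 * eta ^ 2) by ring; pose proof (pow2_ge_0 eta); assert (eta ^ 2 <= 1) by (simpl; nra); nra).
      assert (E : (1 + eta ^ 2) ^ 2 * m ^ 2 = m ^ 2 + (2 * eta ^ 2 + eta ^ 4) * m ^ 2) by ring.
      pose proof (pow2_ge_0 eta). pose proof (pow2_ge_0 m).
      assert ((2 * eta ^ 2 + eta ^ 4) * m ^ 2 <= 3 * eta ^ 2 * 4) by (apply Rmult_le_compat; nra). lra. }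
    assert (Hp : (1 + a) ^ 2 + b ^ 2 <= 12 * eta ^ 2) by nra.
    assert (Hp1 : 1 + a <= 7 / 2 * eta).
    { apply Rnot_lt_le. intros Hc. pose proof (pow2_ge_0 b). assert ((7 / 2 * eta) * (7 / 2 * eta) < (1 + a) * (1 + a)) by nra. nra. }
    assert (Hd20 : den <= 20 * eta ^ 2).
    { unfold den. replace ((1 + eta + a) ^ 2) with ((1 + a) ^ 2 + 2 * eta * (1 + a) + eta ^ 2) by ring. nra. }
    assert (Hm1 : 1 < m ^ 2).
    { assert ((1 + eta ^ 2) ^ 2 <= 4) by (assert (0 <= eta ^ 2 <= 1) by (simpl; nra); nra).
      pose proof (pow2_ge_0 m). nra. }
    assert (Ha2 : / 2 <= 1 - a) by nra.
    unfold v, Rdiv.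
    apply Rle_trans with ((eta * / 2) * / (20 * eta ^ 2)).
    - right. field. lra.
    - apply Rmult_le_compat; [lra| |nra|].
      + apply Rlt_le, Rinv_0_lt_compat. assert (0 < eta ^ 2) by (simpl; nra). lra.
      + apply Rinv_le_contravar; [exact Hden|exact Hd20]. }
  apply Rle_trans with (1 + eta ^ 2); [assert (0 <= eta ^ 2) by (simpl; nra); nra|].
  eapply Rle_trans; [apply exp_ineq1_le|]. apply exp_le_compat.
  apply Rle_trans with (40 * eta ^ 3 * / (40 * eta)).
  - right. field. lra.
  - apply Rmult_le_compat_l; lra.
Qed.

(** The coordinate in which [sinh (w / N_k)] is [exp (w / N_k)] times [(1 - zeta) / 2]. It maps the
    half-plane into the unit disc, and the maxima of the [k]-th term on the imaginary axis all go to
    [zeta = -1]. *)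
Definition nome (k : nat) (w : C) : C := Cexp (RtoC (- (2 / INR (freq k))) * w)%C.

Lemma Csinh_factor (u : C) : Csinh u = (Cexp u * ((1 - Cexp (- (2 * u))) * / 2))%C.
Proof.
  unfold Csinh.
  replace (Cexp (- u)) with (Cexp u * Cexp (- (2 * u)))%C by (rewrite <- Cexp_plus; f_equal; ring).
  ring.
Qed.

Lemma Cmod_nome_le (k : nat) (w : C) : 0 <= fst w -> Cmod (nome k w) <= 1.
Proof.
  intros H. unfold nome. rewrite Cmod_Cexp, <- exp_0. apply exp_le_compat. simpl.
  pose proof (Rinv_0_lt_compat _ (freq_pos k)). unfold Rdiv. nra.
Qed.

Definition weight (k : nat) : R := 40 * INR (freq k) * eta k ^ 3.

(** In the factorisation of [sinh] through [nome], the power [freq k] turns the exponential factor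
    into [exp (fst w)], and turns the estimate of [bump_majorant] into the harmonic function with
    coefficient [weight k]. *)
Lemma term_majorant (k : nat) (w : C) :
  0 <= fst w ->
  0 <= fst (bump (eta k) (nome k w)) /\
  Cmod (term k w) <= (/ 2) ^ k * exp (fst w + weight k * fst (bump (eta k) (nome k w))).
Proof.
  intros Hw. pose proof (Cmod_nome_le k w Hw) as Hn.
  destruct (bump_majorant (eta k) (nome k w)) as [B0 B1]; [split; [apply eta_pos|apply eta_le_1]|exact Hn|].
  split; [exact B0|].
  pose proof (pow_lt (/ 2) k ltac:(lra)) as P. pose proof (freq_pos k) as N.
  unfold term. rewrite Cmod_mult, Cmod_R, Cmod_pow, Rabs_pos_eq by lra.
  apply Rmult_le_compat_l; [lra|].
  replace (exp (fst w + weight k * fst (bump (eta k) (nome k w))))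
    with (exp (fst w / INR (freq k) + 40 * eta k ^ 3 * fst (bump (eta k) (nome k w))) ^ freq k).
  2:{ rewrite exp_pow. f_equal. unfold weight. field. lra. }
  apply pow_incr. split; [apply Cmod_ge_0|].
  unfold base. rewrite Csinh_factor.
  replace (Cexp (- (2 * scaled k w))) with (nome k w).
  2:{ unfold nome, scaled. f_equal. replace (- (2 / INR (freq k))) with (-1 * (2 * / INR (freq k))) by (unfold Rdiv; ring).
      rewrite !RtoC_mult. ring. }
  replace (RtoC (1 + eta k ^ 2) * (Cexp (scaled k w) * ((1 - nome k w) * / 2)))%C
    with (Cexp (scaled k w) * (RtoC (1 + eta k ^ 2) * ((1 - nome k w) * / 2)))%C by ring.
  rewrite Cmod_mult, exp_plus. apply Rmult_le_compat; [apply Cmod_ge_0|apply Cmod_ge_0| |exact B1].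
  right. rewrite Cmod_Cexp. f_equal. unfold scaled; simpl. unfold Rdiv. ring.
Qed.

(** Here [u = Cmod w / freq k] is at most [1 / 8], and [4 u exp u <= 4 * (1 / 8) * 2 = 1]. On a
    bounded set only finitely many terms therefore need a majorant. *)
Lemma term_small (k : nat) (w : C) : 8 * Cmod w <= INR (freq k) -> Cmod (term k w) <= (/ 2) ^ k.
Proof.
  intros H. pose proof (pow_lt (/ 2) k ltac:(lra)) as P. pose proof (freq_pos k) as N.
  unfold term. rewrite Cmod_mult, Cmod_R, Cmod_pow, Rabs_pos_eq by lra.
  rewrite <- Rmult_1_r. apply Rmult_le_compat_l; [lra|]. rewrite <- (pow1 (freq k)).
  apply pow_incr. split; [apply Cmod_ge_0|].
  eapply Rle_trans; [apply (Cmod_base_le k w (Cmod w)); lra|].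
  assert (Hu : Cmod w / INR (freq k) <= / 8).
  { apply Rmult_le_reg_r with (INR (freq k)); [lra|]. unfold Rdiv. rewrite Rmult_assoc, Rinv_l; lra. }
  assert (Hu0 : 0 <= Cmod w / INR (freq k)).
  { apply Rmult_le_pos; [apply Cmod_ge_0|]. apply Rlt_le, Rinv_0_lt_compat, N. }
  set (u := Cmod w / INR (freq k)) in *.
  assert (He : exp u <= 2).
  { pose proof (exp_ineq1_le (- u)) as E. rewrite exp_Ropp in E.
    pose proof (exp_pos u) as E0.
    apply (Rmult_le_compat_r (exp u)) in E; [|lra]. rewrite Rinv_l in E by lra. nra. }
  pose proof (exp_pos u). nra.
Qed.

(** The sum is truncated at [n]: on [Cmod w <= n] the later terms are small anyway, and a finite sum
    of harmonic functions can be integrated term by term. *)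
Definition log_majorant (n : nat) (w : C) : R :=
  fst w + sum_f_R0 (fun k => weight k * fst (bump (eta k) (nome k w))) n.

Lemma weight_pos (k : nat) : 0 < weight k.
Proof. pose proof (freq_pos k). pose proof (pow_lt _ 3 (eta_pos k)). unfold weight. nra. Qed.

Lemma sum_f_R0_ge_term (a : nat -> R) (n k : nat) :
  (forall i, 0 <= a i) -> (k <= n)%nat -> a k <= sum_f_R0 a n.
Proof.
  intros H Hk. induction Hk as [|n Hk IH].
  - destruct k as [|k]; simpl; [lra|]. pose proof (cond_pos_sum a k H). lra.
  - simpl. pose proof (H (S n)). lra.
Qed.

Lemma freq_ge_index (k : nat) : 8 * INR k <= INR (freq k).
Proof.
  rewrite freq_pow. apply Rmult_le_compat_l; [lra|].
  induction k as [|k IH]; [simpl; lra|].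
  pose proof (pow_R1_Rle 4 k ltac:(lra)). rewrite S_INR, <- tech_pow_Rmult. lra.
Qed.

(** Terms up to [n] are controlled by the majorant, later ones by [term_small], since
    [8 n <= 8 k <= freq k]. In the constant [4], one factor [2] is the geometric sum and the other
    comes from [Cmod_CSeries_le]. *)
Lemma spiky_majorant (n : nat) (w : C) :
  0 <= fst w -> Cmod w <= INR n -> Cmod (spiky w) <= 4 * exp (log_majorant n w).
Proof.
  intros Hw Hn.
  assert (Hterm : forall k, 0 <= weight k * fst (bump (eta k) (nome k w))).
  { intros k. apply Rmult_le_pos; [apply Rlt_le, weight_pos|]. apply term_majorant, Hw. }
  assert (HM : 0 <= log_majorant n w).
  { unfold log_majorant. pose proof (cond_pos_sum _ n Hterm). lra. }
  assert (HE : 1 <= exp (log_majorant n w)) by (rewrite <- exp_0; apply exp_le_compat, HM).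
  unfold spiky. eapply Rle_trans.
  - apply (Cmod_CSeries_le _ (fun k => exp (log_majorant n w) * (/ 2) ^ k)); [|apply ex_series_half].
    intros k. pose proof (pow_lt (/ 2) k ltac:(lra)) as P.
    destruct (Compare_dec.le_lt_dec k n) as [Hk|Hk].
    + eapply Rle_trans; [apply term_majorant, Hw|]. rewrite Rmult_comm.
      apply Rmult_le_compat_r; [lra|]. apply exp_le_compat. unfold log_majorant.
      pose proof (sum_f_R0_ge_term _ n k Hterm Hk) as T. cbv beta in T. lra.
    + apply Rle_trans with ((/ 2) ^ k); [|nra]. apply term_small.
      apply lt_INR in Hk. pose proof (freq_ge_index k). lra.
  - rewrite Series_half. lra.
Qed.

Lemma C1_majorant_term (k : nat) :
  exists b', C1_on unit_disc (fun z => bump (eta k) (nome k (cayley z))) b'.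
Proof.
  destruct C1_cayley as [c' Hc].
  assert (Hc' : C1_on unit_disc cayley c') by (intros z Hz; apply Hc, unit_disc_neq_1, Hz).
  assert (Hn : exists n', C1_on unit_disc (fun z => nome k (cayley z)) n').
  { eexists. unfold nome.
    eapply (C1_comp unit_disc (fun _ => True) Cexp Cexp (fun z => RtoC (- (2 / INR (freq k))) * cayley z)%C _).
    - apply C1_Cexp.
    - apply C1_mult; [apply C1_const|exact Hc'].
    - auto. }
  destruct Hn as [n' Hn].
  eexists. unfold bump.
  eapply (C1_mult _ (fun z => 1 - nome k (cayley z))%C _ (fun z => / (RtoC (1 + eta k) + nome k (cayley z)))%C _).
  - apply (C1_plus _ (fun _ => RtoC 1) (fun _ => RtoC 0) (fun z => - nome k (cayley z))%C (fun z => - n' z)%C).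
    + apply C1_const.
    + intros z Hz. destruct (Hn z Hz) as [A B]. split; [apply cderiv_opp, A|].
      apply (ccont_comp Copp n'); [|exact B]. eapply cderiv_ccont, cderiv_opp, cderiv_id.
  - eapply (C1_comp _ _ Cinv _ (fun z => RtoC (1 + eta k) + nome k (cayley z))%C _).
    + apply C1_Cinv.
    + apply C1_plus; [apply C1_const|exact Hn].
    + intros z Hz E. pose proof (cayley_re_pos z Hz) as Hp.
      pose proof (Cmod_nome_le k (cayley z) (Rlt_le _ _ Hp)) as Hm.
      pose proof (Rabs_fst_le_Cmod (nome k (cayley z))) as Hf. apply Rabs_le_between in Hf.
      apply (f_equal fst) in E. change (1 + eta k + fst (nome k (cayley z)) = 0) in E.
      pose proof (eta_pos k). lra.
Qed.

Lemma ex_RInt_C1_re (f f' : C -> C) (r : R) :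
  C1_on unit_disc f f' -> 0 < r < 1 -> ex_RInt (fun theta => fst (f (polar r theta))) 0 (2 * PI).
Proof.
  intros Hf Hr. apply (ex_RInt_continuous (V := R_CompleteNormedModule)). intros x _.
  apply continuous_fst_C.
  apply (continuous_disc_curve R_UniformSpace unit_disc f f' (fun t => polar r t) x Hf).
  - apply unit_disc_polar. rewrite Rabs_pos_eq; lra.
  - apply continuous_polar; [apply continuous_const|apply continuous_id].
Qed.

Lemma majorant_mean (n : nat) (r : R) : 0 < r < 1 ->
  is_RInt (fun theta => log_majorant n (cayley (polar r theta))) 0 (2 * PI) (2 * PI * log_majorant n (RtoC 1)).
Proof.
  intros Hr. unfold log_majorant.
  assert (H1 : is_RInt (fun theta => fst (cayley (polar r theta))) 0 (2 * PI) (2 * PI * fst (RtoC 1))).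
  { destruct C1_cayley as [c' Hc].
    assert (Hc' : C1_on unit_disc cayley c') by (intros z Hz; apply Hc, unit_disc_neq_1, Hz).
    rewrite <- cayley_0, <- (mean_value_property cayley c' r Hc' Hr).
    apply (RInt_correct (V := R_CompleteNormedModule)), (ex_RInt_C1_re _ c'); auto. }
  assert (Hk : forall k, is_RInt (fun theta => weight k * fst (bump (eta k) (nome k (cayley (polar r theta))))) 0 (2 * PI)
             (2 * PI * (weight k * fst (bump (eta k) (nome k (RtoC 1)))))).
  { intros k. destruct (C1_majorant_term k) as [b' Hb].
    replace (2 * PI * (weight k * fst (bump (eta k) (nome k (RtoC 1)))))
      with (weight k * RInt (fun theta => fst (bump (eta k) (nome k (cayley (polar r theta))))) 0 (2 * PI)).
    - apply (is_RInt_scal (V := R_NormedModule)).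
      apply (RInt_correct (V := R_CompleteNormedModule)).
      apply (ex_RInt_C1_re (fun z => bump (eta k) (nome k (cayley z))) b'); auto.
    - rewrite (mean_value_property (fun z => bump (eta k) (nome k (cayley z))) b' r Hb Hr), cayley_0. ring. }
  assert (Hs : is_RInt (fun theta => sum_f_R0 (fun k => weight k * fst (bump (eta k) (nome k (cayley (polar r theta))))) n)
     0 (2 * PI) (2 * PI * sum_f_R0 (fun k => weight k * fst (bump (eta k) (nome k (RtoC 1)))) n)).
  { induction n as [|n IH]; [apply Hk|]. simpl sum_f_R0. rewrite Rmult_plus_distr_l.
    apply (is_RInt_plus (V := R_NormedModule)); [exact IH|apply Hk]. }
  rewrite Rmult_plus_distr_l. apply (is_RInt_plus (V := R_NormedModule)); assumption.
Qed.

(** A telescoping form of the integral of [x^(-3/2)]: with [p = eta n] and [q = eta (S n)], the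
    identity [p^2 - q^2 = p^2 q^2] and [q <= p] give [q^3 <= 2 (p - q)]. *)
Lemma eta_cube_sum (n : nat) : sum_f_R0 (fun k => eta k ^ 3) n <= 3 - 2 * eta n.
Proof.
  induction n as [|n IH].
  - unfold eta; simpl. rewrite sqrt_1. lra.
  - rewrite tech5.
    pose proof (eta_pos n) as P. pose proof (eta_pos (S n)) as Q.
    assert (E1 : eta n ^ 2 = eta (S n) ^ 2 + eta n ^ 2 * eta (S n) ^ 2).
    { rewrite !eta_sqr, !S_INR. pose proof (pos_INR n). field. lra. }
    set (p := eta n) in *. set (q := eta (S n)) in *.
    assert (Hqp : q <= p).
    { apply Rnot_lt_le. intros Hc. pose proof (pow2_ge_0 q). assert (p ^ 2 < q ^ 2) by (simpl; nra). nra. }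
    assert (q ^ 3 <= 2 * p - 2 * q); [|lra].
    apply Rmult_le_reg_r with (p + q); [lra|].
    replace ((2 * p - 2 * q) * (p + q)) with (2 * (p ^ 2 * q ^ 2)) by (simpl in *; nra).
    replace (q ^ 3 * (p + q)) with (q ^ 2 * (q * (p + q))) by ring.
    pose proof (pow2_ge_0 q). replace (2 * (p ^ 2 * q ^ 2)) with (q ^ 2 * (2 * p ^ 2)) by ring.
    apply Rmult_le_compat_l; [assumption|]. simpl; nra.
Qed.

(** At [w = 1] the nome is a real number [a = exp (- x)] with [x = 2 / freq k], so the bump is at
    most [1 - a <= x]. The frequency cancels and leaves [40 * 2 * eta k ^ 3]. *)
Lemma weighted_bump_at_1 (k : nat) : weight k * fst (bump (eta k) (nome k (RtoC 1))) <= 80 * eta k ^ 3.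
Proof.
  pose proof (freq_pos k) as N. pose proof (eta_pos k) as P.
  assert (E : nome k (RtoC 1) = (exp (- (2 / INR (freq k))), 0)).
  { unfold nome, Cexp. simpl.
    replace (- (2 / INR (freq k)) * 0 + 0 * 1) with 0 by ring. rewrite cos_0, sin_0.
    f_equal; [|ring]. rewrite Rmult_1_r. f_equal. ring. }
  rewrite E. set (x := 2 / INR (freq k)).
  assert (Hx : 0 < x) by (apply Rdiv_lt_0_compat; lra).
  pose proof (exp_pos (- x)) as E0. pose proof (exp_ineq1_le (- x)) as E1.
  rewrite bump_re by nra.
  set (a := exp (- x)) in *.
  replace ((1 + eta k - eta k * a - (a ^ 2 + 0 ^ 2)) / ((1 + eta k + a) ^ 2 + 0 ^ 2))
    with ((1 - a) / (1 + eta k + a)) by (field; nra).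
  apply Rle_trans with (weight k * x).
  - apply Rmult_le_compat_l; [apply Rlt_le, weight_pos|].
    apply Rmult_le_reg_r with (1 + eta k + a); [lra|]. unfold Rdiv. rewrite Rmult_assoc, Rinv_l by lra. nra.
  - right. unfold weight, x. field. lra.
Qed.

(** The constant is [1 + 80 * 3]: the value of [Re w] plus the weighted bumps, whose cubes sum to at
    most [3]. It is independent of the truncation [n]. *)
Lemma majorant_at_1 (n : nat) : log_majorant n (RtoC 1) <= 241.
Proof.
  unfold log_majorant. simpl fst at 1.
  apply Rle_trans with (1 + sum_f_R0 (fun k => eta k ^ 3 * 80) n).
  - apply Rplus_le_compat_l. apply sum_Rle. intros k _. pose proof (weighted_bump_at_1 k). lra.
  - rewrite <- (scal_sum (fun k => eta k ^ 3) n 80). pose proof (eta_cube_sum n). pose proof (eta_pos n). lra.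
Qed.

(** * Membership in the Nevanlinna class *)

Lemma log_plus_Rmax (x : R) : log_plus x = ln (Rmax 1 x).
Proof.
  unfold log_plus. destruct (Rle_dec 1 x) as [H|H].
  - rewrite Rmax_right; auto.
  - rewrite Rmax_left by lra. symmetry. apply ln_1.
Qed.

Lemma log_plus_pos (x : R) : 0 <= log_plus x.
Proof.
  rewrite log_plus_Rmax, <- ln_1. pose proof (Rmax_l 1 x) as [H|H].
  - apply Rlt_le, ln_increasing; lra.
  - rewrite <- H. lra.
Qed.

Lemma log_plus_le_exp (x y : R) : 0 <= y -> x <= exp y -> log_plus x <= y.
Proof.
  intros Hy Hx. rewrite log_plus_Rmax.
  assert (H : Rmax 1 x <= exp y) by (apply Rmax_lub; [rewrite <- exp_0; apply exp_le_compat, Hy|exact Hx]).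
  pose proof (Rmax_l 1 x). rewrite <- (ln_exp y).
  destruct H as [H|H]; [apply Rlt_le, ln_increasing; lra|rewrite H; lra].
Qed.

Lemma log_plus_ge_exp (x y : R) : exp y <= x -> y <= log_plus x.
Proof.
  intros H. rewrite log_plus_Rmax. pose proof (Rmax_r 1 x). pose proof (exp_pos y).
  rewrite <- (ln_exp y) at 1.
  assert (H2 : exp y <= Rmax 1 x) by lra.
  destruct H2 as [H2|H2]; [apply Rlt_le, ln_increasing; lra|rewrite H2; lra].
Qed.

Lemma exp_log_plus_ge (x : R) : x <= exp (log_plus x).
Proof. rewrite log_plus_Rmax. pose proof (Rmax_l 1 x). pose proof (Rmax_r 1 x). rewrite exp_ln; lra. Qed.

Lemma log_plus_mult (x y : R) : 0 <= x -> 0 <= y -> log_plus (x * y) <= log_plus x + log_plus y.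
Proof.
  intros Hx Hy. pose proof (log_plus_pos x). pose proof (log_plus_pos y).
  apply log_plus_le_exp; [lra|]. rewrite exp_plus.
  apply Rmult_le_compat; auto using exp_log_plus_ge.
Qed.

Lemma continuous_log_plus (x : R) : continuous log_plus x.
Proof.
  apply (continuous_ext (fun x => ln ((1 + x + Rabs (x - 1)) * / 2))).
  { intros y. rewrite log_plus_Rmax. f_equal. unfold Rmax, Rabs.
    destruct (Rle_dec 1 y), (Rcase_abs (y - 1)); lra. }
  apply (continuous_comp (fun x => (1 + x + Rabs (x - 1)) * / 2) ln).
  - apply (continuous_mult (K := R_AbsRing)); [|apply continuous_const].
    apply (continuous_plus (V := R_NormedModule)).
    + apply (continuous_plus (V := R_NormedModule)); [apply continuous_const|apply continuous_id].
    + apply (continuous_comp (fun x => x - 1) Rabs); [|apply continuous_Rabs].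
      apply (continuous_minus (V := R_NormedModule)); [apply continuous_id|apply continuous_const].
  - apply (ex_derive_continuous (V := R_NormedModule)). exists (/ ((1 + x + Rabs (x - 1)) * / 2)).
    apply is_derive_ln. unfold Rabs. destruct (Rcase_abs (x - 1)); lra.
Qed.

Lemma continuous_log_mean_integrand (f : C -> C) (r theta : R) :
  holomorphic_on_disc f -> 0 < r < 1 -> continuous (fun t => log_plus (Cmod (f (polar r t)))) theta.
Proof.
  intros Hf Hr. apply (continuous_comp (fun t => Cmod (f (polar r t))) log_plus); [|apply continuous_log_plus].
  apply continuous_Cmod.
  apply (continuous_comp (V := C_UniformSpace) (W := C_UniformSpace) (fun t => polar r t) f).
  - apply continuous_polar; [apply continuous_const|apply continuous_id].
  - destruct (Hf (polar r theta)) as [l Hl].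
    + apply unit_disc_polar. rewrite Rabs_pos_eq; lra.
    + apply (cderiv_ccont f _ l Hl).
Qed.

Lemma ex_RInt_log_mean (f : C -> C) (r a b : R) :
  holomorphic_on_disc f -> 0 < r < 1 -> ex_RInt (fun t => log_plus (Cmod (f (polar r t)))) a b.
Proof.
  intros Hf Hr. apply (ex_RInt_continuous (V := R_CompleteNormedModule)).
  intros x _. apply continuous_log_mean_integrand; auto.
Qed.

Lemma Nevanlinna_bounded (f : C -> C) :
  Nevanlinna f <-> holomorphic_on_disc f /\ exists M, forall r, 0 < r < 1 -> log_mean f r <= M.
Proof.
  unfold Nevanlinna.
  destruct (Lub_Rbar_correct (fun m => exists r, 0 < r < 1 /\ m = log_mean f r)) as [U L].
  set (l := Lub_Rbar _) in *. split; intros [H K]; split; auto.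
  - exists (real l). intros r Hr. specialize (U (log_mean f r) (ex_intro _ r (conj Hr eq_refl))).
    destruct l; simpl in *; tauto.
  - destruct K as [M K]. apply Rbar_le_lt_trans with (Finite M); [|exact I].
    apply L. intros m [r [Hr ->]]. apply K, Hr.
Qed.

Lemma Nevanlinna_mult (f g : C -> C) :
  Nevanlinna f -> Nevanlinna g -> Nevanlinna (fun z => f z * g z)%C.
Proof.
  rewrite !Nevanlinna_bounded. intros [Hf [A Ha]] [Hg [B Hb]].
  assert (H : holomorphic_on_disc (fun z => f z * g z)%C).
  { intros z Hz. destruct (Hf z Hz) as [a Da], (Hg z Hz) as [b Db].
    exists (a * g z + f z * b)%C. apply cderiv_mult; assumption. }
  split; [exact H|]. exists (A + B). intros r Hr.
  specialize (Ha r Hr). specialize (Hb r Hr).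
  apply Rle_trans with (log_mean f r + log_mean g r); [|lra].
  unfold log_mean.
  pose proof (ex_RInt_log_mean f r 0 (2 * PI) Hf Hr) as If.
  pose proof (ex_RInt_log_mean g r 0 (2 * PI) Hg Hr) as Ig.
  rewrite <- (RInt_plus (V := R_CompleteNormedModule)) by assumption.
  apply RInt_le.
  - pose proof PI_RGT_0. lra.
  - apply (ex_RInt_log_mean (fun z => f z * g z)%C r); assumption.
  - apply (ex_RInt_plus (V := R_NormedModule)); assumption.
  - intros x _. rewrite Cmod_mult. apply log_plus_mult; apply Cmod_ge_0.
Qed.

Lemma continuous_bounded (f : R -> R) (a b : R) :
  a <= b -> (forall x, a <= x <= b -> continuous f x) -> exists M, forall x, a <= x <= b -> f x <= M.
Proof.
  intros Hab H. destruct (continuity_ab_maj f a b Hab) as [m [Hm _]].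
  - intros x Hx. apply continuity_pt_filterlim, H, Hx.
  - exists (f m). exact Hm.
Qed.

(** For fixed [r] the Cayley image of the circle is bounded, which determines a truncation [n]. The
    mean of the majorant is its value at [cayley 0 = 1], so the final bound depends neither on [n]
    nor on [r]. *)
Lemma Nevanlinna_counterexample : Nevanlinna counterexample.
Proof.
  apply Nevanlinna_bounded.
  destruct C1_counterexample as [h' Hh]. destruct C1_cayley as [c' Hc].
  assert (Hhol : holomorphic_on_disc counterexample).
  { intros z Hz. eexists. apply Hh, unit_disc_neq_1, Hz. }
  split; [exact Hhol|].
  assert (L4 : 0 <= ln 4) by (rewrite <- ln_1; apply Rlt_le, ln_increasing; lra).
  exists (2 * PI * (ln 4 + 241)). intros r Hr.
  assert (Hd : forall theta, unit_disc (polar r theta)) by (intros; apply unit_disc_polar; rewrite Rabs_pos_eq; lra).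
  destruct (continuous_bounded (fun theta => Cmod (cayley (polar r theta))) 0 (2 * PI)) as [W HW].
  { pose proof PI_RGT_0. lra. }
  { intros theta _. apply continuous_Cmod.
    apply (continuous_disc_curve R_UniformSpace _ cayley c' (fun t => polar r t) theta Hc).
    - apply unit_disc_neq_1, Hd.
    - apply continuous_polar; [apply continuous_const|apply continuous_id]. }
  destruct (INR_unbounded W) as [n Hn].
  pose proof (majorant_mean n r Hr) as Hm. pose proof PI_RGT_0 as HPI.
  assert (HI : is_RInt (fun theta => ln 4 + log_majorant n (cayley (polar r theta))) 0 (2 * PI)
            (2 * PI * ln 4 + 2 * PI * log_majorant n (RtoC 1))).
  { apply (is_RInt_plus (V := R_NormedModule) (fun _ => ln 4) (fun theta => log_majorant n (cayley (polar r theta)))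
             0 (2 * PI) (2 * PI * ln 4) (2 * PI * log_majorant n (RtoC 1))); [|exact Hm].
    replace (2 * PI * ln 4) with (scal (2 * PI - 0) (ln 4)) by (unfold scal; simpl; unfold mult; simpl; ring).
    apply (is_RInt_const (V := R_NormedModule)). }
  apply Rle_trans with (2 * PI * ln 4 + 2 * PI * log_majorant n (RtoC 1)).
  - rewrite <- (is_RInt_unique _ _ _ _ HI). unfold log_mean. apply RInt_le.
    + lra.
    + apply (ex_RInt_log_mean counterexample r); assumption.
    + exists (2 * PI * ln 4 + 2 * PI * log_majorant n (RtoC 1)). exact HI.
    + intros theta Ht.
      pose proof (cayley_re_pos _ (Hd theta)) as Hp.
      assert (Hterm : 0 <= log_majorant n (cayley (polar r theta))).
      { unfold log_majorant.
        assert (0 <= sum_f_R0 (fun k => weight k * fst (bump (eta k) (nome k (cayley (polar r theta))))) n); [|lra].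
        apply cond_pos_sum. intros k. apply Rmult_le_pos; [apply Rlt_le, weight_pos|].
        apply term_majorant. lra. }
      apply log_plus_le_exp; [lra|]. rewrite exp_plus, exp_ln by lra.
      apply spiky_majorant; [lra|].
      specialize (HW theta ltac:(lra)). simpl in HW. lra.
  - pose proof (majorant_at_1 n). nra.
Qed.

(** * Peaks on the imaginary axis *)

Lemma Series_ge_term (a : nat -> R) (k : nat) : (forall i, 0 <= a i) -> ex_series a -> a k <= Series a.
Proof.
  revert a. induction k as [|k IH]; intros a Ha Hs.
  - rewrite Series_incr_1 by exact Hs.
    assert (0 <= Series (fun i => a (S i))); [|lra].
    apply Series_nonneg; [auto|]. apply (ex_series_incr_1 (V := R_NormedModule) a), Hs.
  - rewrite Series_incr_1 by exact Hs. specialize (Ha 0%nat) as H0.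
    specialize (IH (fun i => a (S i)) (fun i => Ha (S i))).
    apply (ex_series_incr_1 (V := R_NormedModule) a) in Hs. specialize (IH Hs). lra.
Qed.

Lemma Csinh_imaginary (y : R) : Csinh (0, y) = (0, sin y).
Proof.
  unfold Csinh, Cexp, Copp, Cminus, Cplus, Copp, Cmult, Cinv, RtoC; simpl.
  rewrite Ropp_0, exp_0, cos_neg, sin_neg. f_equal; field.
Qed.

Lemma Cpow_imaginary (u : R) (m : nat) : (((0, u) : C) ^ (4 * m))%C = RtoC (u ^ (4 * m)).
Proof.
  rewrite Cpow_mult_r, pow_mult.
  replace (((0, u) : C) ^ 4)%C with (RtoC (u ^ 4)).
  - symmetry. apply RtoC_pow.
  - unfold RtoC, Cpow, Cmult; simpl. f_equal; ring.
Qed.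

Lemma term_imaginary (k : nat) (y : R) :
  term k (0, y) = RtoC ((/ 2) ^ k * ((1 + eta k ^ 2) * sin (y / INR (freq k))) ^ freq k).
Proof.
  unfold term, base, scaled.
  replace ((0, y) * RtoC (/ INR (freq k)))%C with (0, y / INR (freq k))
    by (unfold Cmult, RtoC, Rdiv; simpl; f_equal; ring).
  rewrite Csinh_imaginary.
  replace (RtoC (1 + eta k ^ 2) * (0, sin (y / INR (freq k))))%C
    with ((0, (1 + eta k ^ 2) * sin (y / INR (freq k))) : C) by (unfold Cmult, RtoC; simpl; f_equal; ring).
  rewrite RtoC_mult. f_equal.
  unfold freq. replace (8 * 4 ^ k)%nat with (4 * (2 * 4 ^ k))%nat by lia.
  apply Cpow_imaginary.
Qed.

Lemma term_imaginary_pos (k : nat) (y : R) : 0 <= fst (term k (0, y)).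
Proof.
  rewrite term_imaginary. unfold RtoC. cbn [fst]. apply Rmult_le_pos; [apply pow_le; lra|].
  set (u := (1 + eta k ^ 2) * _). clearbody u.
  unfold freq. replace (8 * 4 ^ k)%nat with (2 * (4 * 4 ^ k))%nat by lia.
  rewrite pow_mult. apply pow_le, pow2_ge_0.
Qed.

Lemma spiky_imaginary (y : R) :
  snd (spiky (0, y)) = 0 /\ forall k, fst (term k (0, y)) <= fst (spiky (0, y)).
Proof.
  split.
  - unfold spiky, CSeries. cbn [snd].
    rewrite (Series_ext _ (fun k => 0 * 0)).
    + rewrite Series_scal_l. ring.
    + intros k. rewrite term_imaginary. unfold RtoC; cbn [snd]. ring.
  - intros k. unfold spiky, CSeries. cbn [fst].
    apply (Series_ge_term (fun k => fst (term k (0, y)))).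
    + intros i. apply term_imaginary_pos.
    + apply ex_series_Rabs. eapply (Csummable_re_im (fun k => term k (0, y))).
      apply (Csummable_le _ (fun k => 6 * exp (6 * Cmod (0, y)) * (/ 2) ^ k)); [|apply ex_series_half].
      intros i. apply term_bounds. lra.
Qed.

Lemma sin_sqr_le (x : R) : 0 <= x -> sin x * sin x <= x * x.
Proof.
  intros [H| <-]; [|rewrite sin_0; lra].
  destruct (Rle_lt_dec 1 x) as [H1|H1].
  - pose proof (SIN_bound x). nra.
  - pose proof (sin_lt_x _ H). pose proof (sin_gt_0 x H ltac:(pose proof PI2_1; lra)). nra.
Qed.

Lemma cos_ge_quadratic (x : R) : 1 - x ^ 2 / 2 <= cos x.
Proof.
  replace (cos x) with (cos (2 * (x / 2))) by (f_equal; field). rewrite cos_2a_sin.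
  assert (H : sin (x / 2) * sin (x / 2) <= (x / 2) * (x / 2)).
  { destruct (Rle_lt_dec 0 (x / 2)) as [H|H]; [apply sin_sqr_le, H|].
    pose proof (sin_sqr_le (- (x / 2)) ltac:(lra)) as K. rewrite sin_neg in K. lra. }
  lra.
Qed.

Lemma sin_ge_x_cos (x : R) : 0 < x <= 1 -> x * cos x <= sin x.
Proof.
  intros Hx.
  destruct (MVT_gen (fun t => sin t - t * cos t) 0 x (fun t => t * sin t)) as [c [Hc E]].
  - intros t _. auto_derive; [exact I|ring].
  - intros t _. apply continuity_pt_filterlim, (ex_derive_continuous (V := R_NormedModule) (fun t => sin t - t * cos t)).
    auto_derive. exact I.
  - rewrite Rmin_left, Rmax_right in Hc by lra. rewrite sin_0 in E.
    assert (0 <= sin c) by (apply sin_ge_0; pose proof PI2_1; lra).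
    assert (0 <= c * sin c * (x - 0)) by (apply Rmult_le_pos; [nra|lra]). lra.
Qed.

(** On the unit circle the Cayley transform is [i cot (s / 2)]. Replacing the cotangent by [2 / s]
    costs at most [s], which after division by [freq k] is negligible compared with the width of a
    peak. *)
Lemma cot_half_bounds (s : R) : 0 < s <= 1 ->
  0 < sin (s / 2) /\ 2 / s - s <= cos (s / 2) / sin (s / 2) <= 2 / s.
Proof.
  intros Hs. set (u := s / 2). assert (Hu : 0 < u <= / 2) by (unfold u; lra).
  replace s with (2 * u) by (unfold u; field).
  assert (Hsin : 0 < sin u) by (apply sin_gt_0; pose proof PI2_1; lra).
  split; [exact Hsin|].
  replace (2 / (2 * u)) with (/ u) by (field; lra).
  assert (Hiu : u * / u = 1) by (field; lra).
  assert (H2 : 2 <= / u). { apply Rmult_le_reg_l with u; [lra|]. rewrite Hiu. lra. }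
  pose proof (cos_ge_quadratic u) as Hc. pose proof (sin_lt_x u ltac:(lra)) as Hl.
  pose proof (sin_ge_x_cos u ltac:(lra)) as Hg.
  split; apply Rmult_le_reg_r with (sin u); try exact Hsin;
    unfold Rdiv; rewrite Rmult_assoc, Rinv_l, Rmult_1_r by lra.
  - apply Rle_trans with ((/ u - 2 * u) * u); [apply Rmult_le_compat_l; lra|].
    replace ((/ u - 2 * u) * u) with (1 - 2 * u ^ 2) by (field; lra).
    pose proof (pow2_ge_0 u). lra.
  - apply Rmult_le_reg_l with u; [lra|]. rewrite <- Rmult_assoc, Hiu. lra.
Qed.

(* The angles [theta] for which [cot (theta / 2)] is within [eta k * freq k / 2] of the first maximum
   [freq k * PI / 2] of the [k]-th term on the imaginary axis. *)
Definition peak_left (k : nat) : R := 4 / (INR (freq k) * (PI + eta k)).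
Definition peak_right (k : nat) : R := 4 / (INR (freq k) * PI).

Lemma PI_gt_3 : 3 < PI.
Proof. pose proof PI2_3_2. lra. Qed.

Lemma inv_freq_le_eta (k : nat) : 8 * / INR (freq k) <= eta k.
Proof.
  pose proof (freq_ge_8 k) as H8.
  pose proof (lt_0_INR (S k) ltac:(lia)) as P.
  assert (eta k ^ 2 <= eta k) by (pose proof (eta_pos k); pose proof (eta_le_1 k); simpl; nra).
  rewrite eta_sqr in H.
  assert (H8' : 8 * INR (S k) <= INR (freq k)).
  { rewrite freq_pow. apply Rmult_le_compat_l; [lra|]. clear.
    induction k as [|k IH]; [simpl; lra|].
    pose proof (pow_R1_Rle 4 k ltac:(lra)). rewrite S_INR, <- tech_pow_Rmult. lra. }
  apply Rle_trans with (/ INR (S k)); [|exact H].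
  apply Rmult_le_reg_r with (INR (freq k) * INR (S k)); [nra|].
  replace (8 * / INR (freq k) * (INR (freq k) * INR (S k))) with (8 * INR (S k)) by (field; lra).
  replace (/ INR (S k) * (INR (freq k) * INR (S k))) with (INR (freq k)) by (field; lra). exact H8'.
Qed.

(** The estimate of the width amounts to [PI * (PI + eta k) <= 20], which follows from [PI <= 4] and
    [eta k <= 1]. The lower bound for [peak_left] leaves the angles just below [/ (2 * freq k)] free
    for the interval on which the primitive will be measured. *)
Lemma peak_bounds (k : nat) :
  / (2 * INR (freq k)) <= peak_left k /\ peak_right k <= 1 /\
  eta k / (5 * INR (freq k)) <= peak_right k - peak_left k.
Proof.
  pose proof (freq_ge_8 k) as N. pose proof PI_gt_3 as P3. pose proof PI_4 as P4.
  pose proof (eta_pos k) as E0. pose proof (eta_le_1 k) as E1.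
  unfold peak_left, peak_right. repeat split.
  - apply Rmult_le_reg_r with (2 * INR (freq k) * (PI + eta k)); [nra|].
    replace (/ (2 * INR (freq k)) * (2 * INR (freq k) * (PI + eta k))) with (PI + eta k) by (field; lra).
    replace (4 / (INR (freq k) * (PI + eta k)) * (2 * INR (freq k) * (PI + eta k))) with 8 by (field; lra). lra.
  - apply Rmult_le_reg_r with (INR (freq k) * PI); [nra|]. unfold Rdiv. rewrite Rmult_assoc, Rinv_l by nra. nra.
  - replace (4 / (INR (freq k) * PI) - 4 / (INR (freq k) * (PI + eta k)))
      with (eta k / (5 * INR (freq k)) * (20 / (PI * (PI + eta k)))) by (field; lra).
    rewrite <- (Rmult_1_r (eta k / (5 * INR (freq k)))) at 1.
    apply Rmult_le_compat_l; [apply Rmult_le_pos; [lra|apply Rlt_le, Rinv_0_lt_compat; lra]|].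
    apply Rmult_le_reg_r with (PI * (PI + eta k)); [nra|]. unfold Rdiv. rewrite Rmult_assoc, Rinv_l by nra. nra.
Qed.

(** On the peak, [y / freq k] is within [eta k / 2] of [PI / 2]. With [v = eta k ^ 2 / 4] the base
    is then at least [(1 + 4 v) * (1 - v / 2) >= 1 + 2 v >= exp v], where [v <= 1 / 4]. The error of
    the cotangent is absorbed by [inv_freq_le_eta]. *)
Lemma term_peak (k : nat) (s : R) :
  peak_left k <= s <= peak_right k ->
  (/ 2) ^ k * exp (INR (freq k) * eta k ^ 2 / 4) <= fst (term k (0, cos (s / 2) / sin (s / 2))).
Proof.
  intros Hs. destruct (peak_bounds k) as [B1 [B2 _]].
  pose proof (freq_ge_8 k) as N. pose proof PI_gt_3 as P3.
  pose proof (eta_pos k) as E0. pose proof (eta_le_1 k) as E1.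
  assert (Hs0 : 0 < s).
  { assert (0 < / (2 * INR (freq k))) by (apply Rinv_0_lt_compat; lra). lra. }
  destruct (cot_half_bounds s ltac:(lra)) as [Hsin [C1 C2]].
  set (y := cos (s / 2) / sin (s / 2)) in *.
  set (n := INR (freq k)) in *.
  assert (Hn : 0 < / n) by (apply Rinv_0_lt_compat; lra).
  assert (L1 : PI / 2 <= 2 / s * / n).
  { apply Rmult_le_reg_r with (s * n); [nra|].
    replace (2 / s * / n * (s * n)) with 2 by (field; lra).
    assert (s * (n * PI) <= 4).
    { destruct Hs as [_ Hs]. unfold peak_right in Hs. fold n in Hs.
      apply (Rmult_le_compat_r (n * PI)) in Hs; [|nra].
      unfold Rdiv in Hs. rewrite Rmult_assoc, Rinv_l in Hs by nra. lra. }
    lra. }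
  assert (L2 : 2 / s * / n <= PI / 2 + eta k / 2).
  { apply Rmult_le_reg_r with (s * n); [nra|].
    replace (2 / s * / n * (s * n)) with 2 by (field; lra).
    assert (4 <= s * (n * (PI + eta k))).
    { destruct Hs as [Hs _]. unfold peak_left in Hs. fold n in Hs.
      apply (Rmult_le_compat_r (n * (PI + eta k))) in Hs; [|nra].
      unfold Rdiv in Hs. rewrite Rmult_assoc, Rinv_l in Hs by nra. lra. }
    lra. }
  assert (L3 : s * / n <= eta k / 2).
  { pose proof (inv_freq_le_eta k) as I. fold n in I. nra. }
  assert (Hy : Rabs (PI / 2 - y / n) <= eta k / 2).
  { apply Rabs_le. unfold Rdiv at 2 4.
    apply (Rmult_le_compat_r (/ n)) in C1; [|lra]. apply (Rmult_le_compat_r (/ n)) in C2; [|lra].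
    rewrite Rmult_minus_distr_r in C1. lra. }
  rewrite term_imaginary. unfold RtoC; cbn [fst]. fold n.
  apply Rmult_le_compat_l; [apply pow_le; lra|].
  replace (n * eta k ^ 2 / 4) with (n * (eta k ^ 2 / 4)) by field.
  unfold n at 1. rewrite <- exp_pow. apply pow_incr. split; [apply Rlt_le, exp_pos|].
  replace (sin (y / n)) with (cos (PI / 2 - y / n)) by apply cos_shift.
  pose proof (cos_ge_quadratic (PI / 2 - y / n)) as Q.
  rewrite <- (pow2_abs (PI / 2 - y / n)) in Q.
  pose proof (Rabs_pos (PI / 2 - y / n)) as A0.
  assert (Q' : Rabs (PI / 2 - y / n) ^ 2 <= (eta k / 2) ^ 2) by (apply pow_incr; lra).
  set (v := eta k ^ 2 / 4).
  assert (Hv : 0 <= v <= / 4) by (unfold v; simpl; nra).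
  replace (eta k ^ 2) with (4 * v) by (unfold v; field).
  replace ((eta k / 2) ^ 2) with v in Q' by (unfold v; field).
  apply Rle_trans with (1 + 2 * v).
  - pose proof (exp_ineq1_le (- v)) as E. rewrite exp_Ropp in E. pose proof (exp_pos v).
    apply (Rmult_le_compat_r (exp v)) in E; [|lra]. rewrite Rinv_l in E by lra. nra.
  - apply Rle_trans with ((1 + 4 * v) * (1 - v / 2)); [nra|]. apply Rmult_le_compat_l; lra.
Qed.

(** * Growth of the radial primitive *)

(** The imaginary part of the primitive is the useful one: by [radial_primitive_derive] its angular
    derivative is [angular_speed], a real part that is nonnegative on the boundary arc
    [0 < theta <= 1]. *)
Definition radial (z : C) : R := RInt (fun t => snd (counterexample (RtoC t * z) * z)%C) 0 1.

Definition angular_speed (r theta : R) : R := fst (counterexample (polar r theta) * polar r theta)%C.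

Lemma sin_pos_01 (theta : R) : 0 < theta <= 1 -> 0 < sin theta.
Proof. intros H. apply sin_gt_0; pose proof PI_gt_3; lra. Qed.

Lemma polar_neq_1 (r theta : R) : 0 <= r -> 0 < theta <= 1 -> polar r theta <> RtoC 1.
Proof.
  intros Hr Ht E. pose proof (sin_pos_01 theta Ht).
  assert (E1 := f_equal fst E). assert (E2 := f_equal snd E). unfold polar in E1, E2. simpl in E1, E2.
  assert (r * sin theta = 0) by lra.
  assert (r = 0) by (apply Rmult_integral in H0; destruct H0; lra). subst r. lra.
Qed.

Lemma continuous_counterexample_curve (U : UniformSpace) (c : U -> C) (x : U) :
  c x <> RtoC 1 -> continuous (T := U) (U := C_UniformSpace) c x ->
  continuous (T := U) (U := C_UniformSpace) (fun y => counterexample (c y)) x.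
Proof.
  intros H Hc. destruct C1_counterexample as [h' Hh].
  apply (continuous_disc_curve U _ counterexample h' c x Hh H Hc).
Qed.

Lemma continuous_angular_speed (U : UniformSpace) (f g : U -> R) (x : U) :
  0 <= f x -> 0 < g x <= 1 -> continuous f x -> continuous g x ->
  continuous (fun y => angular_speed (f y) (g y)) x.
Proof.
  intros H1 H2 Hf Hg. unfold angular_speed. apply continuous_fst_C.
  assert (Hp := continuous_polar U f g x Hf Hg).
  apply (continuous_Cmult U (fun y => counterexample (polar (f y) (g y))) (fun y => polar (f y) (g y))); [|exact Hp].
  apply (continuous_counterexample_curve U (fun y => polar (f y) (g y))); [|exact Hp].
  apply polar_neq_1; assumption.
Qed.

Lemma is_RInt_angular_speed (r a b : R) :
  0 < r < 1 -> 0 < a <= 1 -> 0 < b <= 1 ->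
  is_RInt (angular_speed r) a b (radial (polar r b) - radial (polar r a)).
Proof.
  intros Hr Ha Hb. destruct C1_counterexample as [h' Hh].
  assert (Hh' : C1_on unit_disc counterexample h') by (intros z Hz; apply Hh, unit_disc_neq_1, Hz).
  apply (is_RInt_derive (V := R_CompleteNormedModule) (fun x => radial (polar r x)) (angular_speed r)).
  - intros x _. apply (radial_primitive_derive counterexample h' r x Hh' Hr).
  - intros x Hx. assert (0 < x <= 1).
    { unfold Rmin, Rmax in Hx. destruct (Rle_dec a b); lra. }
    apply (continuous_angular_speed R_UniformSpace (fun _ => r) (fun y => y) x); try lra.
    + apply continuous_const.
    + apply continuous_id.
Qed.

(** Boundary values are real and nonnegative, so the speed is [spiky] times [cos s], and
    [cos s >= 1 / 2] for [s <= 1]. Since all terms are nonnegative, each single one is a lower bound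
    for the sum. *)
Lemma angular_speed_boundary (s : R) : 0 < s <= 1 ->
  0 <= angular_speed 1 s /\
  forall k, fst (term k (0, cos (s / 2) / sin (s / 2))) / 2 <= angular_speed 1 s.
Proof.
  intros Hs. destruct (cot_half_bounds s Hs) as [Hsin _].
  assert (E : angular_speed 1 s = fst (spiky (0, cos (s / 2) / sin (s / 2))) * cos s).
  { unfold angular_speed, counterexample. rewrite cayley_circle by lra.
    destruct (spiky_imaginary (cos (s / 2) / sin (s / 2))) as [E _].
    unfold polar, Cmult, RtoC. cbn [fst snd]. rewrite E. ring. }
  rewrite E. destruct (spiky_imaginary (cos (s / 2) / sin (s / 2))) as [_ P].
  set (y := cos (s / 2) / sin (s / 2)) in *.
  assert (Hc : / 2 <= cos s).
  { pose proof (cos_ge_quadratic s). assert (s ^ 2 <= 1) by (simpl; nra). lra. }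
  split.
  - specialize (P 0%nat). pose proof (term_imaginary_pos 0 y). apply Rmult_le_pos; lra.
  - intros k. specialize (P k). pose proof (term_imaginary_pos k y). unfold Rdiv. apply Rmult_le_compat; lra.
Qed.

(* Uniform continuity transfers the lower bounds on the unit circle to circles of radius close to [1]. *)
Lemma angular_speed_lower (a : R) : 0 < a <= 1 ->
  exists r0, / 2 <= r0 < 1 /\ forall r s, r0 < r < 1 -> a <= s <= 1 -> angular_speed 1 s - 1 <= angular_speed r s.
Proof.
  intros Ha.
  destruct (uniform_continuity_2d angular_speed (/ 2) 1 a 1) with (eps := mkposreal 1 Rlt_0_1) as [d Hd].
  { intros x y Hx Hy. apply continuous_2d.
    apply (continuous_angular_speed C_UniformSpace (fun p => fst p) (fun p => snd p) (x, y)); simpl; try lra.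
    - apply continuous_pair_fst.
    - apply continuous_pair_snd. }
  exists (Rmax (/ 2) (1 - d)). pose proof (cond_pos d).
  split; [split; [apply Rmax_l|apply Rmax_lub_lt; lra]|].
  intros r s Hr Hs.
  pose proof (Rmax_l (/ 2) (1 - d)). pose proof (Rmax_r (/ 2) (1 - d)).
  specialize (Hd 1 s r s ltac:(lra) ltac:(lra) ltac:(lra) ltac:(lra)).
  rewrite Rminus_eq_0, Rabs_R0 in Hd.
  specialize (Hd ltac:(apply Rabs_def1; lra) ltac:(lra)). simpl in Hd.
  apply Rabs_def2 in Hd. lra.
Qed.

(** The radius at angle [1] stays away from the singular point, so it provides a base point from
    which the angular speed is integrated. *)
Lemma radial_bounded : exists B, forall r, 0 < r < 1 -> Rabs (radial (polar r 1)) <= B.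
Proof.
  destruct (continuous_bounded (fun s => Cmod (counterexample (polar s 1))) 0 1) as [B HB]; [lra| |].
  { intros s Hs. apply continuous_Cmod.
    apply (continuous_counterexample_curve R_UniformSpace (fun s => polar s 1)).
    - apply polar_neq_1; lra.
    - apply continuous_polar; [apply continuous_id|apply continuous_const]. }
  exists B. intros r Hr. unfold radial.
  assert (E : forall t, (RtoC t * polar r 1)%C = polar (t * r) 1) by (intros t; unfold polar; rewrite RtoC_mult; ring).
  replace B with ((1 - 0) * B) by ring.
  apply abs_RInt_le_const; [lra| |].
  - apply (ex_RInt_continuous (V := R_CompleteNormedModule)). intros t Ht.
    rewrite Rmin_left, Rmax_right in Ht by lra.
    assert (Hc : continuous (T := R_UniformSpace) (U := C_UniformSpace) (fun t => (RtoC t * polar r 1)%C) t).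
    { apply continuous_Cmult; [apply continuous_RtoC, continuous_id|apply continuous_const]. }
    apply continuous_snd_C, continuous_Cmult; [|apply continuous_const].
    apply (continuous_counterexample_curve R_UniformSpace (fun t => (RtoC t * polar r 1)%C) t); [|exact Hc].
    rewrite E. apply polar_neq_1; nra.
  - intros t Ht. eapply Rle_trans; [apply Rabs_snd_le_Cmod|].
    rewrite Cmod_mult, E, Cmod_polar, Rabs_pos_eq by lra.
    pose proof (HB (t * r) ltac:(nra)) as K. cbv beta in K.
    pose proof (Cmod_ge_0 (counterexample (polar (t * r) 1))). nra.
Qed.

Lemma RInt_ge_const (f : R -> R) (a b m : R) :
  a <= b -> ex_RInt f a b -> (forall x, a < x < b -> m <= f x) -> m * (b - a) <= RInt f a b.
Proof.
  intros Hab Hf H.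
  replace (m * (b - a)) with (RInt (fun _ => m) a b).
  - apply RInt_le; auto. apply ex_RInt_const.
  - rewrite RInt_const. unfold scal; simpl; unfold mult; simpl. ring.
Qed.

(** The minimum of the term on its peak, halved because of the cosine, times the lower bound for the
    width of the peak. *)
Definition peak_height (k : nat) : R :=
  (/ 2) ^ k * exp (INR (freq k) * eta k ^ 2 / 4) / 2 * (eta k / (5 * INR (freq k))).

(** Integrating the speed from [theta] up to angle [1] crosses the whole peak. Passing from the
    circle to radius [r] loses at most [1] per unit angle, hence at most [1] in total, and the value
    at angle [1] is bounded; together they form [B]. Only [r0] depends on [a]; [B] does not, and
    [r0] serves every [k] at once. *)
Lemma radial_lower :
  exists B, 0 <= B /\ forall a, 0 < a <= 1 -> exists r0, / 2 <= r0 < 1 /\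
    forall r k theta, r0 < r < 1 -> a <= theta <= peak_left k ->
      peak_height k - B <= Rabs (radial (polar r theta)).
Proof.
  destruct radial_bounded as [B HB].
  assert (HB0 : 0 <= B).
  { specialize (HB (/ 2) ltac:(lra)). pose proof (Rabs_pos (radial (polar (/ 2) 1))). lra. }
  exists (B + 1). split; [lra|].
  intros a Ha. destruct (angular_speed_lower a Ha) as [r0 [Hr0 K]].
  exists r0. split; [exact Hr0|]. intros r k theta Hr Ht.
  specialize (HB r ltac:(lra)). destruct (peak_bounds k) as [_ [P1 P2]].
  pose proof (freq_pos k) as N. pose proof (eta_pos k) as E0.
  assert (Hw : 0 < eta k / (5 * INR (freq k))) by (apply Rdiv_lt_0_compat; lra).
  set (p := peak_left k) in *. set (q := peak_right k) in *.
  set (A := (/ 2) ^ k * exp (INR (freq k) * eta k ^ 2 / 4) / 2).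
  assert (HA : 0 < A).
  { unfold A. pose proof (pow_lt (/ 2) k ltac:(lra)). pose proof (exp_pos (INR (freq k) * eta k ^ 2 / 4)).
    apply Rdiv_lt_0_compat; [|lra]. apply Rmult_lt_0_compat; assumption. }
  assert (I : forall u v, 0 < u <= 1 -> 0 < v <= 1 -> ex_RInt (angular_speed r) u v).
  { intros u v Hu Hv. eexists. apply is_RInt_angular_speed; auto; lra. }
  assert (L : forall u v m, a <= u -> u <= v -> v <= 1 -> (forall s, u < s < v -> m <= angular_speed 1 s) ->
     (m - 1) * (v - u) <= RInt (angular_speed r) u v).
  { intros u v m Hu Huv Hv H. apply RInt_ge_const; [exact Huv|apply I; lra|].
    intros s Hs. specialize (K r s Hr ltac:(lra)). specialize (H s Hs). lra. }
  assert (Hpos : forall s, 0 < s <= 1 -> 0 <= angular_speed 1 s) by (intros; apply angular_speed_boundary; auto).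
  pose proof (L theta p 0 ltac:(lra) ltac:(lra) ltac:(lra) ltac:(intros; apply Hpos; lra)) as L1.
  pose proof (L q 1 0 ltac:(lra) ltac:(lra) ltac:(lra) ltac:(intros; apply Hpos; lra)) as L3.
  assert (L2 : (A - 1) * (q - p) <= RInt (angular_speed r) p q).
  { apply L; try lra. intros s Hs.
    destruct (angular_speed_boundary s ltac:(lra)) as [_ T]. specialize (T k).
    pose proof (term_peak k s ltac:(fold p; fold q; lra)) as T'. unfold A. lra. }
  assert (HI : RInt (angular_speed r) theta 1 = radial (polar r 1) - radial (polar r theta)).
  { apply is_RInt_unique, is_RInt_angular_speed; lra. }
  pose proof (RInt_Chasles (V := R_CompleteNormedModule) (angular_speed r) theta p q
    ltac:(apply I; lra) ltac:(apply I; lra)) as C1.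
  pose proof (RInt_Chasles (V := R_CompleteNormedModule) (angular_speed r) theta q 1
    ltac:(apply I; lra) ltac:(apply I; lra)) as C2.
  unfold plus in C1, C2; simpl in C1, C2.
  assert (HAq : A * (eta k / (5 * INR (freq k))) <= A * (q - p)) by (apply Rmult_le_compat_l; lra).
  unfold peak_height. fold A.
  apply Rabs_le_between in HB. pose proof (Rle_abs (- radial (polar r theta))) as Q. rewrite Rabs_Ropp in Q. lra.
Qed.

(** * Exponential heights of the peaks against the divergence of the harmonic series *)

Lemma exp_ge_pow6 (u : R) : 0 <= u -> u ^ 6 / 46656 <= exp u.
Proof.
  intros H. replace (u ^ 6 / 46656) with ((u / 6) ^ 6) by field.
  replace u with (INR 6 * (u / 6)) at 2 by (simpl; field). rewrite <- exp_pow.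
  apply pow_incr. pose proof (exp_ineq1_le (u / 6)). lra.
Qed.

Lemma pow2_ge_S (k : nat) : INR (S k) <= 2 ^ k.
Proof.
  induction k as [|k IH]; [simpl; lra|].
  pose proof (pow_R1_Rle 2 k ltac:(lra)). rewrite S_INR, <- tech_pow_Rmult. lra.
Qed.

Lemma peak_height_eventually (B : R) : 0 <= B ->
  (* With [t = 2^k] and [x = freq k * eta k ^ 2 / 8 = t^2 / (k + 1) >= t], the peak height is at
     least [exp (2 x) / (80 t^4)]. One factor [exp x] is spent on [80 t^4 (1 + B)], by
     [exp t >= t^6 / 6^6], and the other survives. The threshold is [3732480 = 80 * 6^6]. *)
  exists k0, forall k, (k0 <= k)%nat -> exp (INR (freq k) * eta k ^ 2 / 8) <= peak_height k - B.
Proof.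
  intros HB. destruct (INR_unbounded (3732480 * (1 + B))) as [k0 Hk0].
  exists k0. intros k Hk. apply le_INR in Hk.
  pose proof (pow2_ge_S k) as H2. rewrite S_INR in H2.
  assert (E2 : 1 <= 2 ^ k) by (apply pow_R1_Rle; lra).
  assert (E4 : 4 ^ k = 2 ^ k * 2 ^ k) by (rewrite <- Rpow_mult_distr; f_equal; lra).
  assert (HS : 0 < INR (S k)) by (apply lt_0_INR; lia).
  assert (HS2 : INR (S k) <= 2 ^ k) by apply pow2_ge_S.
  set (t := 2 ^ k) in *.
  assert (Ht : t ^ 6 / 46656 >= 80 * t ^ 4 * (1 + B)).
  { assert (t ^ 2 >= 3732480 * (1 + B)) by (simpl; nra).
    replace (t ^ 6) with (t ^ 4 * t ^ 2) by ring.
    assert (0 < t ^ 4) by (apply pow_lt; lra). nra. }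
  rewrite freq_pow, E4, eta_sqr.
  replace (8 * (t * t) * / INR (S k) / 8) with (t * t / INR (S k)) by (field; lra).
  unfold peak_height. rewrite freq_pow, E4, eta_sqr.
  replace (8 * (t * t) * / INR (S k) / 4) with (t * t / INR (S k) + t * t / INR (S k)) by (field; lra).
  set (x := t * t / INR (S k)).
  assert (Hx : t <= x).
  { unfold x. apply Rmult_le_reg_r with (INR (S k)); [exact HS|]. unfold Rdiv. rewrite Rmult_assoc, Rinv_l by lra. nra. }
  assert (Hex : 80 * t ^ 4 * (1 + B) <= exp x).
  { apply Rle_trans with (exp t); [|apply exp_le_compat, Hx]. pose proof (exp_ge_pow6 t ltac:(lra)). lra. }
  rewrite exp_plus, pow_inv. fold t.
  assert (He : / t <= eta k).
  { assert (eta k ^ 2 <= eta k) by (pose proof (eta_pos k); pose proof (eta_le_1 k); simpl; nra).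
    rewrite eta_sqr in H. apply Rle_trans with (/ INR (S k)); [|exact H]. apply Rinv_le_contravar; lra. }
  assert (Hq : / (80 * t ^ 4) <= / t / 2 * (eta k / (5 * (8 * (t * t))))).
  { replace (/ (80 * t ^ 4)) with (/ t / 2 * (/ t / (5 * (8 * (t * t))))) by (field; lra).
    apply Rmult_le_compat_l; [apply Rmult_le_pos; [apply Rlt_le, Rinv_0_lt_compat; lra|lra]|].
    apply Rmult_le_compat_r; [apply Rlt_le, Rinv_0_lt_compat; nra|exact He]. }
  replace (/ t * (exp x * exp x) / 2 * (eta k / (5 * (8 * (t * t)))))
    with (exp x * exp x * (/ t / 2 * (eta k / (5 * (8 * (t * t)))))) by (field; lra).
  assert (Hxx : 1 + B <= exp x * / (80 * t ^ 4)).
  { assert (0 < t ^ 4) by (apply pow_lt; lra).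
    apply Rmult_le_reg_r with (80 * t ^ 4); [lra|]. rewrite Rmult_assoc, Rinv_l by lra. lra. }
  pose proof (exp_pos x) as Px.
  assert (H1 : exp x * exp x * / (80 * t ^ 4) <= exp x * exp x * (/ t / 2 * (eta k / (5 * (8 * (t * t))))))
    by (apply Rmult_le_compat_l; [nra|exact Hq]).
  assert (Hx1 : 1 <= exp x) by (rewrite <- exp_0; apply exp_le_compat; lra).
  assert (H3 : exp x * (1 + B) <= exp x * (exp x * / (80 * t ^ 4))) by (apply Rmult_le_compat_l; lra).
  nra.
Qed.

Lemma harmonic_lower (k0 n : nat) :
  ln (INR (S (S (k0 + n)))) - ln (INR (S k0)) <= sum_f_R0 (fun i => / INR (S (k0 + i))) n.
Proof.
  assert (Step : forall m : nat, ln (INR (S (S m))) - ln (INR (S m)) <= / INR (S m)).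
  { intros m. pose proof (lt_0_INR (S m) ltac:(lia)) as P. pose proof (lt_0_INR (S (S m)) ltac:(lia)) as P'.
    rewrite <- ln_div by assumption. rewrite <- (ln_exp (/ INR (S m))).
    assert (H : INR (S (S m)) / INR (S m) <= exp (/ INR (S m))).
    { replace (INR (S (S m)) / INR (S m)) with (1 + / INR (S m)) by (rewrite (S_INR (S m)); field; lra).
      apply exp_ineq1_le. }
    assert (0 < INR (S (S m)) / INR (S m)) by (apply Rdiv_lt_0_compat; assumption).
    destruct H as [H|H]; [apply Rlt_le, ln_increasing; assumption|rewrite H; lra]. }
  induction n as [|n IH].
  - cbn [sum_f_R0]. rewrite Nat.add_0_r. apply Step.
  - rewrite tech5. specialize (Step (k0 + S n)%nat).
    replace (k0 + S n)%nat with (S (k0 + n)) in * by lia. lra.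
Qed.

(** The primitive is measured on the angles between [window k] and [2 * window k = / (2 * freq k)],
    which lie below [peak_left k]. As the frequencies quadruple, these intervals are disjoint. *)
Definition window (k : nat) : R := / (4 * INR (freq k)).

Lemma window_pos (k : nat) : 0 < window k.
Proof. apply Rinv_0_lt_compat. pose proof (freq_pos k). lra. Qed.

Lemma window_S (k : nat) : 4 * window (S k) = window k.
Proof. unfold window. rewrite !freq_pow, <- tech_pow_Rmult. pose proof (pow_lt 4 k ltac:(lra)). field. lra. Qed.

Lemma window_le (k : nat) : 32 * window k <= 1.
Proof.
  unfold window. pose proof (freq_ge_8 k).
  apply Rmult_le_reg_r with (4 * INR (freq k)); [lra|]. rewrite Rmult_assoc, Rinv_l; lra.
Qed.

(** Height [freq k * eta k ^ 2 / 8] times length [/ (4 * freq k)] is [eta k ^ 2 / 32], a multiple of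
    a harmonic term. The induction adds windows towards angle [0]; the gaps contribute nonnegative
    amounts. *)
Lemma windows_sum (u : R -> R) (k0 n : nat) :
  (forall a b, ex_RInt u a b) -> (forall x, 0 <= u x) ->
  (forall i x, (i <= n)%nat -> window (k0 + i) <= x <= 2 * window (k0 + i) ->
     INR (freq (k0 + i)) * eta (k0 + i) ^ 2 / 8 <= u x) ->
  / 32 * sum_f_R0 (fun i => / INR (S (k0 + i))) n <= RInt u (window (k0 + n)) 1.
Proof.
  intros Hu H0 H.
  assert (One : forall i, (i <= n)%nat ->
     / 32 * / INR (S (k0 + i)) <= RInt u (window (k0 + i)) (2 * window (k0 + i))).
  { intros i Hi. pose proof (window_pos (k0 + i)) as W.
    replace (/ 32 * / INR (S (k0 + i)))
      with (INR (freq (k0 + i)) * eta (k0 + i) ^ 2 / 8 * (2 * window (k0 + i) - window (k0 + i))).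
    - apply RInt_ge_const; [lra|apply Hu|]. intros x Hx. apply (H i); [exact Hi|lra].
    - rewrite eta_sqr. unfold window. pose proof (freq_pos (k0 + i)).
      pose proof (lt_0_INR (S (k0 + i)) ltac:(lia)). field. lra. }
  assert (Pos : forall a b, a <= b -> 0 <= RInt u a b).
  { intros a b Hab. pose proof (RInt_ge_const u a b 0 Hab (Hu a b) (fun x _ => H0 x)). lra. }
  assert (Ch : forall a b c, RInt u a c = RInt u a b + RInt u b c).
  { intros a b c. symmetry. apply (RInt_Chasles (V := R_CompleteNormedModule) u); apply Hu. }
  clear H. induction n as [|n IH].
  - cbn [sum_f_R0]. rewrite (Ch _ (2 * window (k0 + 0)) _).
    specialize (One 0%nat ltac:(lia)). pose proof (window_le (k0 + 0)). pose proof (window_pos (k0 + 0)).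
    pose proof (Pos (2 * window (k0 + 0)) 1 ltac:(lra)). lra.
  - rewrite tech5, Rmult_plus_distr_l.
    rewrite (Ch _ (2 * window (k0 + S n)) _), (Ch (2 * window (k0 + S n)) (window (k0 + n)) 1).
    specialize (IH (fun i Hi => One i ltac:(lia))). specialize (One (S n) ltac:(lia)).
    replace (k0 + S n)%nat with (S (k0 + n)) in * by lia.
    pose proof (window_S (k0 + n)). pose proof (window_pos (S (k0 + n))).
    pose proof (Pos (2 * window (S (k0 + n))) (window (k0 + n)) ltac:(lra)). lra.
Qed.

(** A bound [M] on the means fixes how many windows are needed for a contradiction, and only then is
    [r] taken close to [1]. Holomorphy of [T], part of the assumed membership, makes the integrals
    genuine. *)
Lemma not_Nevanlinna_of_radial (T : C -> C) :
  (forall z, unit_disc z -> z <> RtoC 0 -> Rabs (radial z) <= Cmod (T z)) -> ~ Nevanlinna T.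
Proof.
  intros HT HN. destruct (proj1 (Nevanlinna_bounded T) HN) as [Hol [M HM]].
  destruct radial_lower as [B [HB HL]]. destruct (peak_height_eventually B HB) as [k0 Hk0].
  (* The factor [32] compensates [/ 32] in [windows_sum], and the extra [1] makes the final
     inequality strict. *)
  destruct (INR_unbounded (exp (32 * Rabs M + 1 + ln (INR (S k0))))) as [n Hn].
  pose proof (harmonic_lower k0 n) as Hh.
  assert (Hlog : 32 * Rabs M + 1 + ln (INR (S k0)) <= ln (INR (S (S (k0 + n))))).
  { rewrite <- (ln_exp (32 * Rabs M + 1 + ln (INR (S k0)))). apply Rlt_le, ln_increasing; [apply exp_pos|].
    eapply Rlt_le_trans; [apply Hn|]. apply le_INR. lia. }
  pose proof (window_pos (k0 + n)) as W. pose proof (window_le (k0 + n)) as W1.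
  (* The left end of the innermost window is the smallest angle involved, so a single radius is
     valid on all the windows. *)
  destruct (HL (window (k0 + n)) ltac:(lra)) as [r0 [Hr0 K]].
  set (r := (r0 + 1) / 2). assert (Hr : r0 < r < 1) by (unfold r; lra).
  specialize (HM r ltac:(lra)).
  set (u := fun theta => log_plus (Cmod (T (polar r theta)))) in *.
  assert (Hu : forall a b, ex_RInt u a b) by (intros; apply (ex_RInt_log_mean T r); [exact Hol|lra]).
  assert (Hu0 : forall x, 0 <= u x) by (intros; apply log_plus_pos).
  assert (Anti : forall i, (i <= n)%nat -> window (k0 + n) <= window (k0 + i)).
  { intros i Hi. unfold window. apply Rinv_le_contravar; [pose proof (freq_pos (k0 + i)); lra|].
    rewrite !freq_pow. apply Rmult_le_compat_l; [lra|]. apply Rmult_le_compat_l; [lra|].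
    apply Rle_pow; [lra|lia]. }
  assert (HS := windows_sum u k0 n Hu Hu0).
  assert (HS' : / 32 * sum_f_R0 (fun i => / INR (S (k0 + i))) n <= RInt u (window (k0 + n)) 1).
  { apply HS. intros i x Hi Hx. unfold u. apply log_plus_ge_exp.
    specialize (Anti i Hi). destruct (peak_bounds (k0 + i)) as [P _].
    assert (E2 : 2 * window (k0 + i) = / (2 * INR (freq (k0 + i)))).
    { unfold window. pose proof (freq_pos (k0 + i)). field. lra. }
    specialize (K r (k0 + i)%nat x Hr ltac:(lra)). specialize (Hk0 (k0 + i)%nat ltac:(lia)).
    assert (Hd : unit_disc (polar r x)) by (apply unit_disc_polar; rewrite Rabs_pos_eq; lra).
    assert (Hz : polar r x <> RtoC 0).
    { intros E. assert (Cmod (polar r x) = 0) by (rewrite E; apply Cmod_0).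
      rewrite Cmod_polar, Rabs_pos_eq in H by lra. lra. }
    specialize (HT _ Hd Hz). lra. }
  assert (Pos : forall a b, a <= b -> 0 <= RInt u a b).
  { intros a b Hab. pose proof (RInt_ge_const u a b 0 Hab (Hu a b) (fun x _ => Hu0 x)). lra. }
  assert (Ch : forall a b c, RInt u a c = RInt u a b + RInt u b c).
  { intros a b c. symmetry. apply (RInt_Chasles (V := R_CompleteNormedModule) u); apply Hu. }
  unfold log_mean in HM. fold u in HM. pose proof PI_gt_3.
  rewrite (Ch 0 (window (k0 + n)) (2 * PI)), (Ch (window (k0 + n)) 1 (2 * PI)) in HM.
  pose proof (Pos 0 (window (k0 + n)) ltac:(lra)). pose proof (Pos 1 (2 * PI) ltac:(lra)).
  pose proof (Rle_abs M). lra.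
Qed.

(** * The Volterra operator applied to the quotient by the derivative of the symbol *)

Lemma Volterra_counterexample (g : C -> C) (z : C) :
  (forall w, unit_disc w -> C_derive g w <> RtoC 0) -> unit_disc z -> z <> RtoC 0 ->
  (z * Volterra g (fun w => counterexample w * / C_derive g w) z)%C =
  RInt (V := C_R_CompleteNormedModule) (fun t => (counterexample (RtoC t * z) * z)%C) 0 1.
Proof.
  intros Hg Hz H0. unfold Volterra. destruct (Ceq_dec z (RtoC 0)) as [E|_]; [contradiction|].
  rewrite Cmult_assoc, Cinv_r, Cmult_1_l by exact H0. unfold segment_integral.
  apply (RInt_ext (V := C_R_CompleteNormedModule)). intros t Ht. rewrite Rmin_left, Rmax_right in Ht by lra.
  replace (RtoC 0 + RtoC t * (z - RtoC 0))%C with (RtoC t * z)%C by ring.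
  replace (z - RtoC 0)%C with z by ring.
  assert (Hd : unit_disc (RtoC t * z)).
  { unfold unit_disc in *. rewrite Cmod_mult, Cmod_R, Rabs_pos_eq by lra. pose proof (Cmod_ge_0 z). nra. }
  specialize (Hg _ Hd). match goal with |- @eq _ ?a ?b => change (@eq C a b) end. field. exact Hg.
Qed.

Lemma radial_eq_snd (z : C) : unit_disc z ->
  radial z = snd (RInt (V := C_R_CompleteNormedModule) (fun t => (counterexample (RtoC t * z) * z)%C) 0 1).
Proof.
  intros Hz. unfold radial. apply is_RInt_unique.
  apply (is_RInt_fct_extend_snd (U := R_NormedModule) (V := R_NormedModule)
    (fun t => (counterexample (RtoC t * z) * z)%C)).
  apply (RInt_correct (V := C_R_CompleteNormedModule)).
  apply (ex_RInt_continuous (V := C_R_CompleteNormedModule)). intros t Ht.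
  rewrite Rmin_left, Rmax_right in Ht by lra.
  apply (continuous_Cmult R_UniformSpace (fun t => counterexample (RtoC t * z)%C) (fun _ => z)); [|apply continuous_const].
  apply (continuous_counterexample_curve R_UniformSpace (fun t => (RtoC t * z)%C) t).
  - apply unit_disc_neq_1. unfold unit_disc in *. rewrite Cmod_mult, Cmod_R, Rabs_pos_eq by lra.
    pose proof (Cmod_ge_0 z). nra.
  - apply continuous_Cmult; [apply continuous_RtoC, continuous_id|apply continuous_const].
Qed.

(* Since Cinv is total (with value 0 at 0), the fact that g' has no zeros in the
   disc, which is part of "1/g' is holomorphic", is a separate hypothesis. *)
Theorem mainTheorem2 :
  forall g : C -> C,
    holomorphic_on_disc g ->
    (forall z : C, unit_disc z -> C_derive g z <> RtoC 0) ->
    Nevanlinna (fun z : C => (/ C_derive g z)%C) ->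
    exists f : C -> C, Nevanlinna f /\ ~ Nevanlinna (Volterra g f).
Proof.
  intros g _ Hg HN.
  exists (fun w => counterexample w * / C_derive g w)%C. split.
  - apply (Nevanlinna_mult counterexample (fun z => / C_derive g z)%C); [apply Nevanlinna_counterexample|exact HN].
  - apply not_Nevanlinna_of_radial. intros z Hz H0.
    rewrite radial_eq_snd, <- (Volterra_counterexample g z Hg Hz H0) by exact Hz.
    (* The factor [z] has modulus below [1], so passing from the primitive to its quotient by [z]
       can only increase the modulus. *)
    eapply Rle_trans; [apply Rabs_snd_le_Cmod|]. rewrite Cmod_mult. unfold unit_disc in Hz.
    pose proof (Cmod_ge_0 (Volterra g (fun w => counterexample w * / C_derive g w)%C z)). nra.
Qed.
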